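(* Let $k$ be a field with $\operatorname{char}k=0$ or $\operatorname{char}k>7$, let $\mathcal O$ be an octonion algebra over $k$, $G=\operatorname{Aut}(\mathcal O)$ (of type $G_2$), $W=e^\perp$ the pure octonions, and let $V'=\{\sum_ia_ib_i\in\mathrm{S}^2W\mid\sum_i\langle a_i,b_i\rangle=0\}$ (the irreducible $27$-dimensional $G$-representation of highest weight $2\omega_1$). Define bilinear products on $\mathrm{S}^2W$ by $$ab\odot_1cd=(a*c)(b*d)+(a*d)(b*c)+\tfrac27\big(\langle a,c\rangle\langle b,d\rangle+\langle a,d\rangle\langle b,c\rangle\big)\mathrm{id}_W,$$ $$ab\odot_2cd=\langle a,c\rangle bd+\langle a,d\rangle bc+\langle b,c\rangle ad+\langle b,d\rangle ac-\tfrac27\big(\langle a,c\rangle\langle b,d\rangle+\langle a,d\rangle\langle b,c\rangle\big)\mathrm{id}_W$$ for $a,b,c,d\in W$. Then the space of commutative $G$-equivariant (bilinear) products on $V'$ is spanned by the restrictions of $\odot_1$ and $\odot_2$ to $V'$.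
   Context: An octonion algebra over $k$ is an $8$-dimensional $k$-algebra $\mathcal{O}$ with identity $e$ and a nondegenerate quadratic form $N$ with $N(xy)=N(x)N(y)$; put $\langle x,y\rangle=N(x+y)-N(x)-N(y)$ and $W=e^\perp$ (dimension 7). The Malcev product is $a*b=ab-ba$; it maps $W\times W$ to $W$. In $\mathrm{S}^2W$, $ab$ denotes the symmetric product of $a,b\in W$; $\mathrm{S}^2W$ is identified with the space of operators on $W$ symmetric for $\langle\cdot,\cdot\rangle$ via $ab\mapsto\tfrac12(a\langle b,\cdot\rangle+b\langle a,\cdot\rangle)$, so $\mathrm{id}_W\in\mathrm{S}^2W$. $V'$ is denoted $\sigma(V)$ in the source, being the image of the $27$-dimensional irreducible summand $V$ of $A(\mathfrak g_2)$ under the equivariant embedding $\sigma$ into $\operatorname{End}(W)$. *)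

(* Defs.v *)
From HB Require Import structures.
From mathcomp Require Import all_boot all_order all_algebra ring.

Set Implicit Arguments.
Unset Strict Implicit.
Unset Printing Implicit Defensive.

Import GRing.Theory.
Local Open Scope ring_scope.

Definition polar (k : fieldType) (V : vectType k) (N : V -> k) (x y : V) : k :=
  N (x + y) - N x - N y.

Record octonion_algebra (k : fieldType) := OctonionAlgebra {
  ocar :> vectType k;
  omul : {bilinear ocar -> ocar -> ocar};
  oone : ocar;
  onorm : ocar -> k;
  odim : \dim {: ocar} = 8;
  omul1l : left_id oone omul;
  omul1r : right_id oone omul;
  onormZ : forall (a : k) (x : ocar), onorm (a *: x) = a ^+ 2 * onorm x;
  (* linearity in the first argument suffices, as [polar] is symmetric *)
  opolar_linear : forall y : ocar, scalar ((polar onorm)^~ y);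
  onorm_nondegenerate :
    forall x : ocar, (forall y, polar onorm x y = 0) -> x = 0;
  onormM : forall x y : ocar, onorm (omul x y) = onorm x * onorm y
}.

Section PureOctonions.

Variables (k : fieldType) (O : octonion_algebra k).

Definition pairing (x y : O) : k := polar (@onorm k O) x y.

Lemma pairingC x y : pairing x y = pairing y x.
Proof. by rewrite /pairing /polar [y + x]addrC -!addrA [- _ - _]addrC. Qed.

Lemma pairing_linearl y : scalar (pairing^~ y).
Proof. exact: opolar_linear. Qed.

Lemma pairing_linearr x : scalar (pairing x).
Proof. by move=> a y z; rewrite /= !(pairingC x) pairing_linearl. Qed.

HB.instance Definition _ :=
  bilinear_isBilinear.Build k O O k _ _ pairing (pairing_linearl, pairing_linearr).

Definition pairing_one (x : O) : k^o := pairing x (oone O).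

Fact pairing_one_linear : linear pairing_one.
Proof. exact: pairing_linearl. Qed.
HB.instance Definition _ :=
  GRing.isLinear.Build k O k^o _ pairing_one pairing_one_linear.

(* The pure octonions $W = e^\perp$. *)
Definition pureV : {vspace O} := lker (linfun pairing_one).

Lemma mem_pureV x : (x \in pureV) = (pairing x (oone O) == 0).
Proof. by rewrite memv_ker lfunE. Qed.

Definition pure := subvs_of pureV.

Definition form (a b : pure) : k := pairing (vsval a) (vsval b).

Fact form_linearl b : scalar (form^~ b).
Proof. by move=> x u v; rewrite /form linearP pairing_linearl. Qed.

Fact form_linearr a : scalar (form a).
Proof. by move=> x u v; rewrite /form linearP pairing_linearr. Qed.

HB.instance Definition _ :=
  bilinear_isBilinear.Build k pure pure k _ _ form (form_linearl, form_linearr).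

Lemma formC a b : form a b = form b a.
Proof. exact: pairingC. Qed.

Definition commutator (x y : O) : O := omul O x y - omul O y x.

(* The projection is harmless: the commutator is pure, see [commutator_pure]. *)
Definition malcev (a b : pure) : pure :=
  vsproj pureV (commutator (vsval a) (vsval b)).

Fact commutator_linearl y : linear (commutator^~ y).
Proof.
move=> x u v; rewrite /commutator linearPl linearPr scalerBr opprD.
by rewrite addrACA.
Qed.

Fact commutator_linearr x : linear (commutator x).
Proof.
move=> a u v; rewrite /commutator linearPl linearPr scalerBr opprD.
by rewrite addrACA.
Qed.

HB.instance Definition _ :=
  bilinear_isBilinear.Build k O O O _ _ commutator
    (commutator_linearl, commutator_linearr).

Fact malcev_linearl b : linear (malcev^~ b).
Proof.
by move=> x u v; rewrite /malcev [vsval (_ + _)]linearP commutator_linearl linearP.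
Qed.

Fact malcev_linearr a : linear (malcev a).
Proof.
by move=> x u v; rewrite /malcev [vsval (_ + _)]linearP commutator_linearr linearP.
Qed.

HB.instance Definition _ :=
  bilinear_isBilinear.Build k pure pure pure _ _ malcev
    (malcev_linearl, malcev_linearr).

(* The operator $\frac12(a\langle b,\cdot\rangle + b\langle a,\cdot\rangle)$. *)
Definition symop_fun (a b w : pure) : pure :=
  2%:R^-1 *: (form b w *: a + form a w *: b).

Fact symop_fun_linear a b : linear (symop_fun a b).
Proof.
move=> x u v; rewrite /symop_fun !form_linearr.
rewrite ![(_ + form _ v) *: _]scalerDl -!(scalerA x).
by rewrite addrACA -scalerDr [LHS]scalerDr scalerA mulrC -scalerA.
Qed.
HB.instance Definition _ a b :=
  GRing.isLinear.Build k pure pure _ (symop_fun a b) (symop_fun_linear a b).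

Definition symop (a b : pure) : 'End(pure) := linfun (symop_fun a b).

Lemma symopE a b w : symop a b w = 2%:R^-1 *: (form b w *: a + form a w *: b).
Proof. exact: lfunE. Qed.

Lemma symopC a b : symop a b = symop b a.
Proof. by apply/lfunP => w; rewrite !symopE addrC. Qed.

Fact symop_linearl b : linear (symop^~ b).
Proof.
move=> x u v; apply/lfunP => w; rewrite add_lfunE scale_lfunE !symopE.
rewrite form_linearl [form b w *: (_ + _)]scalerDr [(_ + form v w) *: _]scalerDl.
rewrite [form b w *: (x *: u)]scalerA [form b w * x]mulrC -!(scalerA x).
by rewrite addrACA -scalerDr [LHS]scalerDr scalerA mulrC -scalerA.
Qed.

Fact symop_linearr a : linear (symop a).
Proof. by move=> x u v; rewrite !(symopC a) symop_linearl. Qed.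

HB.instance Definition _ :=
  bilinear_isBilinear.Build k pure pure 'End(pure) _ _ symop
    (symop_linearl, symop_linearr).

Local Notation m := (\dim {: pure}).

Definition pbase (i : 'I_m) : pure := (vbasis {: pure})`_i.

(* $\mathrm S^2 W$, as the space of operators spanned by the products $ab$;
   by [mem_S2V] these are all the operators symmetric for [form]. *)
Definition S2V : {vspace 'End(pure)} :=
  <<[seq symop a b | a <- vbasis {: pure}, b <- vbasis {: pure}]>>%VS.

Definition S2 := subvs_of S2V.

Definition sym (a b : pure) : S2 := vsproj S2V (symop a b).

Definition S2id : S2 := vsproj S2V \1%VF.

Lemma sum_pbase a : a = \sum_i coord (vbasis {: pure}) i a *: pbase i.
Proof. exact: coord_vbasis (memvf a). Qed.

Lemma symop_in_S2V a b : symop a b \in S2V.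
Proof.
rewrite (sum_pbase a) linear_sumlz; apply: memv_suml => i _.
rewrite linearZl_LR /=; apply: memvZ.
rewrite (sum_pbase b) linear_sumr; apply: memv_suml => j _.
rewrite linearZr_LR /=; apply: memvZ.
by apply: memv_span; apply: allpairs_f; rewrite memt_nth.
Qed.

Lemma val_sym a b : vsval (sym a b) = symop a b.
Proof. exact: vsprojK (symop_in_S2V a b). Qed.

Lemma symC a b : sym a b = sym b a.
Proof. by rewrite /sym symopC. Qed.

Fact sym_linearl b : linear (sym^~ b).
Proof. by move=> x u v; rewrite /sym symop_linearl linearP. Qed.

Fact sym_linearr a : linear (sym a).
Proof. by move=> x u v; rewrite /sym symop_linearr linearP. Qed.

HB.instance Definition _ :=
  bilinear_isBilinear.Build k pure pure S2 _ _ sym (sym_linearl, sym_linearr).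

Definition gram : 'M[k]_m := \matrix_(i, j) form (pbase i) (pbase j).

(* The basis dual to [pbase] for [form]. *)
Definition pdual (i : 'I_m) : pure := \sum_j invmx gram i j *: pbase j.

(* Every [A] in $\mathrm S^2 W$ is the sum of the products
   $A(b^i)\, b_i$ for dual bases $(b_i)$, $(b^i)$ of $W$, so a linear (resp.
   bilinear) map on $\mathrm S^2 W$ prescribed on the products $ab$ is given by
   the formulas below; see [contractE], [odot1E] and [odot2E]. *)
Definition S2extend2 (phi : pure -> pure -> pure -> pure -> S2) (A B : S2) : S2 :=
  \sum_i \sum_j
    phi (vsval A (pdual i)) (pbase i) (vsval B (pdual j)) (pbase j).

Definition odot1_on (a b c d : pure) : S2 :=
  sym (malcev a c) (malcev b d) + sym (malcev a d) (malcev b c)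
  + (2%:R / 7%:R * (form a c * form b d + form a d * form b c)) *: S2id.

Definition odot2_on (a b c d : pure) : S2 :=
  form a c *: sym b d + form a d *: sym b c
  + form b c *: sym a d + form b d *: sym a c
  - (2%:R / 7%:R * (form a c * form b d + form a d * form b c)) *: S2id.

Definition odot1 : S2 -> S2 -> S2 := S2extend2 odot1_on.
Definition odot2 : S2 -> S2 -> S2 := S2extend2 odot2_on.

Fact linD (U V : lmodType k) (f g : U -> V) :
  linear f -> linear g -> linear (fun x => f x + g x).
Proof. by move=> fL gL x u v; rewrite fL gL scalerDr addrACA. Qed.

Fact linN (U V : lmodType k) (f : U -> V) :
  linear f -> linear (fun x => - f x).
Proof. by move=> fL x u v; rewrite fL opprD scalerN. Qed.

Fact linZ (U V : lmodType k) c (f : U -> V) :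
  linear f -> linear (fun x => c *: f x).
Proof. by move=> fL x u v; rewrite fL scalerDr !scalerA mulrC. Qed.

Fact linS (U V : lmodType k) (h : U -> k) (z : V) :
  scalar h -> linear (fun x => h x *: z).
Proof. by move=> hL x u v; rewrite hL scalerDl scalerA. Qed.

Fact lin_sum (U V : lmodType k) n (f : 'I_n -> U -> V) :
  (forall i, linear (f i)) -> linear (fun x => \sum_i f i x).
Proof.
move=> fL x u v; rewrite scaler_sumr -big_split /=.
by apply: eq_bigr => i _; apply: fL.
Qed.

Fact S2extend2_linearl phi B : (forall b c d, linear (fun a => phi a b c d)) ->
  linear (fun A => S2extend2 phi A B).
Proof.
move=> phiL; apply: lin_sum => i; apply: lin_sum => j x u v.
by rewrite linearP /= add_lfunE scale_lfunE phiL.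
Qed.

Fact S2extend2_linearr phi A : (forall a b d, linear (fun c => phi a b c d)) ->
  linear (S2extend2 phi A).
Proof.
move=> phiL; apply: lin_sum => i; apply: lin_sum => j x u v.
by rewrite linearP /= add_lfunE scale_lfunE phiL.
Qed.

Fact odot1_on_linear1 b c d : linear (fun a => odot1_on a b c d).
Proof.
apply: linD; first by apply: linD => x u v; rewrite malcev_linearl sym_linearl.
by apply: linS => x u v; rewrite !form_linearl; ring.
Qed.

Fact odot1_on_linear3 a b d : linear (fun c => odot1_on a b c d).
Proof.
apply: linD.
  by apply: linD => x u v; rewrite malcev_linearr (sym_linearl, sym_linearr).
by apply: linS => x u v; rewrite !form_linearr; ring.
Qed.

Fact odot1_onC12 a b c d : odot1_on a b c d = odot1_on b a c d.
Proof.
rewrite /odot1_on [form b c * _]mulrC [form b d * _]mulrC.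
rewrite [form a d * _ + _]addrC [sym (malcev b c) _]symC [sym (malcev b d) _]symC.
by rewrite [sym (malcev a d) _ + _]addrC.
Qed.

Fact odot1_onC34 a b c d : odot1_on a b c d = odot1_on a b d c.
Proof.
rewrite /odot1_on [form a d * _ + _]addrC.
by rewrite [sym (malcev a d) _ + _]addrC.
Qed.

Fact odot2_on_linear1 b c d : linear (fun a => odot2_on a b c d).
Proof.
apply: linD; last first.
  by apply: linN; apply: linS => x u v; rewrite !form_linearl; ring.
apply: linD; last by apply: linZ => x u v; rewrite sym_linearl.
apply: linD; last by apply: linZ => x u v; rewrite sym_linearl.
by apply: linD; apply: linS; apply: form_linearl.
Qed.

Fact odot2_on_linear3 a b d : linear (fun c => odot2_on a b c d).
Proof.
apply: linD; last first.
  by apply: linN; apply: linS => x u v; rewrite !form_linearr; ring.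
apply: linD; last by apply: linZ => x u v; rewrite sym_linearr.
apply: linD; last by apply: linS; apply: form_linearr.
apply: linD; first by apply: linS; apply: form_linearr.
by apply: linZ => x u v; rewrite sym_linearr.
Qed.

Fact odot2_onC12 a b c d : odot2_on a b c d = odot2_on b a c d.
Proof.
rewrite /odot2_on [form b c * _]mulrC [form b d * _]mulrC.
rewrite [form a d * _ + _]addrC -[form a c *: _ + _ + _ + _]addrA.
by rewrite [form a c *: _ + _ + _]addrC addrA.
Qed.

Fact odot2_onC34 a b c d : odot2_on a b c d = odot2_on a b d c.
Proof.
rewrite /odot2_on [form a d * _ + _]addrC -[form a c *: _ + _ + _ + _]addrA.
by rewrite [form a c *: _ + _]addrC [form b c *: _ + _]addrC addrA.
Qed.

HB.instance Definition _ := bilinear_isBilinear.Build k S2 S2 S2 _ _ odot1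
  (fun B => S2extend2_linearl B odot1_on_linear1,
   fun A => S2extend2_linearr A odot1_on_linear3).

HB.instance Definition _ := bilinear_isBilinear.Build k S2 S2 S2 _ _ odot2
  (fun B => S2extend2_linearl B odot2_on_linear1,
   fun A => S2extend2_linearr A odot2_on_linear3).

Definition contract (A : S2) : k^o := \sum_i form (vsval A (pdual i)) (pbase i).

Fact contract_linear : linear contract.
Proof.
apply: (@lin_sum S2 k^o) => i x u v.
by rewrite linearP /= add_lfunE scale_lfunE form_linearl.
Qed.
HB.instance Definition _ := GRing.isLinear.Build k S2 k^o _ contract contract_linear.

(* The elements $\sum_i a_i b_i$ with $\sum_i\langle a_i,b_i\rangle = 0$, see
   [mem_V27]. *)
Definition V27 : {vspace S2} := lker (linfun contract).

Section CharNot2.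

Hypothesis k2 : 2%:R != 0 :> k.

Lemma onorm1 : onorm (oone O) = 1.
Proof.
have [n1|] := eqVneq (onorm (oone O)) 0; last first.
  move=> nz; apply: (mulfI nz); rewrite mulr1.
  by rewrite -onormM omul1l.
have n0 (x : O) : onorm x = 0 by rewrite -(omul1l x) onormM n1 mul0r.
have x0 (x : O) : x = 0.
  by apply: onorm_nondegenerate => y; rewrite /polar !n0 !subr0.
have : \dim {: O} = 0%N.
  by apply/eqP; rewrite dimv_eq0 -subv0; apply/subvP=> v _; rewrite (x0 v) mem0v.
by rewrite odim.
Qed.

Lemma pairing11 : pairing (oone O) (oone O) = 2%:R.
Proof.
rewrite /pairing /polar -[X in onorm (X + X)]scale1r -scalerDl onormZ onorm1.
by ring.
Qed.

Lemma form_nondegenerate a : (forall b, form a b = 0) -> a = 0.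
Proof.
move=> a0; apply: val_inj; apply: onorm_nondegenerate => y.
rewrite -[polar _ _ _]/(pairing (vsval a) y).
have ae : pairing (vsval a) (oone O) = 0.
  by apply/eqP; rewrite -mem_pureV subvsP.
pose t := pairing y (oone O) / 2%:R.
have yt : y - t *: oone O \in pureV.
  rewrite mem_pureV addrC -scaleNr pairing_linearl pairing11 mulNr divfK //.
  by rewrite addNr.
have := a0 (vsproj pureV (y - t *: oone O)); rewrite /form vsprojK //.
by rewrite addrC -scaleNr pairing_linearr ae mulr0 add0r.
Qed.

Lemma commutator_pure x y : commutator x y \in pureV.
Proof.
suff H (u v : O) : pairing (omul O u v) (oone O)
    = pairing u (oone O) * pairing v (oone O) - pairing u v.
  rewrite mem_pureV /commutator addrC -scaleN1r pairing_linearl !H (pairingC y x).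
  by apply/eqP; ring.
have ND (w z : O) : onorm (w + z) = pairing w z + onorm w + onorm z :> k.
  by rewrite /pairing /polar; ring.
have Nl (w z : O) : pairing (omul O w z) w = onorm w * pairing z (oone O).
  have := onormM w (z + oone O); rewrite linearDr /= omul1r !ND onormM onorm1.
  by move=> E; apply: (addIr (onorm w * onorm z + onorm w)); rewrite addrA E; ring.
have Nr (w z : O) : pairing (omul O z w) w = onorm w * pairing z (oone O).
  have := onormM (z + oone O) w; rewrite linearDl /= omul1l !ND onormM onorm1.
  by move=> E; apply: (addIr (onorm z * onorm w + onorm w)); rewrite addrA E; ring.
have pDl (a b c : O) : pairing (a + b) c = pairing a c + pairing b c.
  by rewrite -{1}[a]scale1r pairing_linearl mul1r.
have pDr (a b c : O) : pairing c (a + b) = pairing c a + pairing c b.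
  by rewrite !(pairingC c) pDl.
have := onormM (u + oone O) (v + oone O).
have -> : omul O (u + oone O) (v + oone O) = omul O u v + (u + v) + oone O.
  by rewrite linearDl /= omul1l linearDr /= omul1r !addrA.
rewrite !ND !pDl pDr Nl Nr onormM onorm1 => E.
apply: (addIr (pairing u (oone O) + pairing v (oone O) + onorm u * onorm v
  + onorm u + onorm v + pairing u v + 1
  + onorm u * pairing v (oone O) + onorm v * pairing u (oone O))).
rewrite -[RHS]addrA; apply: etrans; last (apply: etrans; first exact: E); ring.
Qed.

Lemma val_malcev a b : vsval (malcev a b) = commutator (vsval a) (vsval b).
Proof. exact: vsprojK (commutator_pure _ _). Qed.

Lemma gram_unit : gram \in unitmx.
Proof.
rewrite -row_free_unit; apply: inj_row_free => v vG.
have v0 : \sum_i v 0 i *: pbase i = 0.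
  apply: form_nondegenerate => b; rewrite (sum_pbase b) linear_sumr big1 // => j _.
  rewrite linearZr_LR /= linear_sumlz.
  have := congr1 (fun M : 'rV_m => M 0 j) vG; rewrite !mxE => vGj.
  rewrite (eq_bigr (fun i => v 0 i * gram i j)) ?vGj ?mulr0 // => i _.
  by rewrite linearZl_LR mxE.
apply/rowP => i; rewrite mxE.
by have /freeP /(_ (v 0)) -> := basis_free (vbasisP {: pure}).
Qed.

Lemma form_pdual i j : form (pdual i) (pbase j) = (i == j)%:R.
Proof.
have := congr1 (fun M : 'M_m => M i j) (mulVmx gram_unit).
rewrite !mxE => <-; rewrite linear_sumlz; apply: eq_bigr => l _.
by rewrite linearZl_LR mxE.
Qed.

Lemma sum_form_pdual a : \sum_i form a (pdual i) *: pbase i = a.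
Proof.
rewrite [RHS]sum_pbase; apply: eq_bigr => i _; congr (_ *: _).
rewrite {1}(sum_pbase a) linear_sumlz (bigD1 i) //= linearZl_LR /= formC.
rewrite form_pdual eqxx mulr1 big1 ?addr0 // => j ji.
by rewrite linearZl_LR /= formC form_pdual eq_sym (negPf ji) mulr0.
Qed.

Lemma sum_form_pbase a : \sum_i form a (pbase i) *: pdual i = a.
Proof.
apply/eqP; rewrite -subr_eq0; apply/eqP; apply: form_nondegenerate => b.
rewrite (sum_pbase b) linear_sumr big1 // => j _; rewrite linearZr_LR /=.
rewrite addrC -scaleN1r form_linearl linear_sumlz (bigD1 j) //= linearZl_LR /=.
rewrite form_pdual eqxx big1 ?addr0 ?mulr1 ?mulN1r ?addNr ?mulr0 // => i ij.
by rewrite linearZl_LR /= form_pdual (negPf ij) mulr0.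
Qed.

Let half (V : lmodType k) (v : V) : 2%:R^-1 *: (v + v) = v.
Proof. by rewrite -mulr2n -scaler_nat scalerA mulVf // scale1r. Qed.

Lemma selfadjoint_sum (A : 'End(pure)) :
    (forall u v, form (A u) v = form u (A v)) ->
  A = \sum_i symop (A (pdual i)) (pbase i).
Proof.
move=> Asym; apply/lfunP => w; rewrite sum_lfunE.
rewrite (eq_bigr _ (fun i _ => symopE _ _ _)) -scaler_sumr big_split /=.
rewrite -[LHS]half; congr (_ *: (_ + _)).
  rewrite -{1}(sum_form_pbase w) linear_sum; apply: eq_bigr => i _.
  by rewrite linearZ formC.
rewrite -{1}(sum_form_pdual (A w)); apply: eq_bigr => i _.
by rewrite Asym formC.
Qed.

Lemma mem_S2V (A : 'End(pure)) :
  A \in S2V <-> forall u v, form (A u) v = form u (A v).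
Proof.
split=> [/(coord_span (X := in_tuple _)) -> u v | /selfadjoint_sum ->].
  rewrite !sum_lfunE linear_sumlz linear_sumr; apply: eq_bigr => i _.
  rewrite !scale_lfunE linearZl_LR linearZr_LR /=; congr (_ * _).
  have /allpairsP[[a b] [_ _ ->]] /= := mem_nth 0 (ltn_ord i).
  rewrite !symopE linearZl_LR linearZr_LR /= !(linearDl, linearDr) /=.
  by rewrite !(linearZl_LR, linearZr_LR) /= !(formC u) (formC a v) (formC b v); ring.
by apply: memv_suml => i _; apply: symop_in_S2V.
Qed.

Lemma val_S2id : vsval S2id = \1%VF.
Proof. by apply: vsprojK; apply/mem_S2V => u v; rewrite !id_lfunE. Qed.

Lemma S2_sum_sym (A : S2) : A = \sum_i sym (vsval A (pdual i)) (pbase i).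
Proof.
apply: subvs_inj; rewrite linear_sum /= {1}(selfadjoint_sum ((mem_S2V _).1 (subvsP A))).
by apply: eq_bigr => i _; rewrite val_sym.
Qed.

Lemma S2extendE (V : lmodType k) (phi : pure -> pure -> V) a b :
    (forall y, linear (phi^~ y)) -> (forall x y, phi x y = phi y x) ->
  \sum_i phi (vsval (sym a b) (pdual i)) (pbase i) = phi a b.
Proof.
move=> phiL phiC.
have phi0 y : phi 0 y = 0 by have := phiL y (-1) 0 0; rewrite scaler0 addr0 scaleN1r addNr.
have phiD y u v : phi (u + v) y = phi u y + phi v y.
  by have := phiL y 1 u v; rewrite !scale1r.
have phiZ y c u : phi (c *: u) y = c *: phi u y.
  by have := phiL y c u 0; rewrite !addr0 phi0 addr0.
have phi_sum x y : \sum_i form x (pdual i) *: phi y (pbase i) = phi y x.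
  rewrite -{2}(sum_form_pdual x) phiC.
  rewrite (big_morph (phi^~ y) (phiD y) (phi0 y)).
  by apply: eq_bigr => i _; rewrite phiZ phiC.
rewrite -[RHS]half [in X in _ + X]phiC -(phi_sum b a) -(phi_sum a b).
rewrite -big_split scaler_sumr /=.
by apply: eq_bigr => i _; rewrite val_sym symopE phiZ phiD !phiZ.
Qed.

Lemma S2extend2E phi a b c d :
    (forall b c d, linear (fun a => phi a b c d)) ->
    (forall a b d, linear (fun c => phi a b c d)) ->
    (forall a b c d, phi a b c d = phi b a c d) ->
    (forall a b c d, phi a b c d = phi a b d c) ->
  S2extend2 phi (sym a b) (sym c d) = phi a b c d.
Proof.
move=> L1 L3 C12 C34; rewrite /S2extend2.
rewrite -(@S2extendE _ (fun x y => phi x y c d)) //.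
by apply: eq_bigr => i _; rewrite -(@S2extendE _ (phi _ _)).
Qed.

(* The defining formulas of the two products on $\mathrm S^2 W$. *)
Lemma odot1E a b c d : odot1 (sym a b) (sym c d) =
  sym (malcev a c) (malcev b d) + sym (malcev a d) (malcev b c)
  + (2%:R / 7%:R * (form a c * form b d + form a d * form b c)) *: S2id.
Proof.
apply: S2extend2E; [exact: odot1_on_linear1 | exact: odot1_on_linear3
                   | exact: odot1_onC12 | exact: odot1_onC34].
Qed.

Lemma odot2E a b c d : odot2 (sym a b) (sym c d) =
  form a c *: sym b d + form a d *: sym b c
  + form b c *: sym a d + form b d *: sym a c
  - (2%:R / 7%:R * (form a c * form b d + form a d * form b c)) *: S2id.
Proof.
apply: S2extend2E; [exact: odot2_on_linear1 | exact: odot2_on_linear3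
                   | exact: odot2_onC12 | exact: odot2_onC34].
Qed.

Lemma contractE a b : contract (sym a b) = form a b.
Proof. exact: (@S2extendE k^o form _ _ form_linearl formC). Qed.

Lemma mem_V27 (A : S2) : A \in V27 <->
  exists s : seq (pure * pure),
    A = \sum_(p <- s) sym p.1 p.2 /\ \sum_(p <- s) form p.1 p.2 = 0.
Proof.
rewrite memv_ker lfunE /=; split=> [/eqP A0 | [s [-> s0]]].
  exists [seq (vsval A (pdual i), pbase i) | i <- index_enum 'I_m].
  by rewrite !big_map -S2_sum_sym.
rewrite linear_sum; apply/eqP; rewrite -[RHS]s0.
by apply: eq_bigr => p _; apply: contractE.
Qed.

End CharNot2.
End PureOctonions.

(* Extension of scalars from [k] to a commutative [k]-algebra [R]: the free
   module $V\otimes_k R$ is given by coordinates in [vbasis {: V}]. *)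
Section BaseChange.

Variables (k : fieldType) (R : comAlgType k).

Definition scalar_ext (V : vectType k) := 'rV[R]_(\dim {: V}).

Definition ext_vec (V : vectType k) (v : V) : scalar_ext V :=
  \row_i (coord (vbasis {: V}) i v)%:A.

Definition ext_lin (U V : vectType k) (f : U -> V) (u : scalar_ext U) :
    scalar_ext V :=
  \sum_i u 0 i *: ext_vec (f (vbasis {: U})`_i).

Definition ext_bil (U V T : vectType k) (f : U -> V -> T)
    (u : scalar_ext U) (v : scalar_ext V) : scalar_ext T :=
  \sum_i \sum_j (u 0 i * v 0 j) *:
    ext_vec (f (vbasis {: U})`_i (vbasis {: V})`_j).

Fact ext_vec_comb (V : vectType k) n (c : 'I_n -> k) (v : 'I_n -> V) :
  ext_vec (\sum_i c i *: v i) = \sum_i (c i)%:A *: ext_vec (v i).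
Proof.
apply/rowP => j; rewrite mxE summxE linear_sum /= -!/(in_alg R _) rmorph_sum /=.
by apply: eq_bigr => i _; rewrite linearZ /= !mxE -!/(in_alg R _) rmorphM.
Qed.

Lemma ext_lin_vec (U V : vectType k) (f : {linear U -> V}) u :
  ext_lin f (ext_vec u) = ext_vec (f u).
Proof.
rewrite [in RHS](coord_vbasis (memvf u)) linear_sum.
rewrite (eq_bigr _ (fun i _ => linearZ_LR _ _ _)) ext_vec_comb.
by apply: eq_bigr => i _; rewrite mxE.
Qed.

Lemma ext_bil_vec (U V T : vectType k) (f : {bilinear U -> V -> T}) u v :
  ext_bil f (ext_vec u) (ext_vec v) = ext_vec (f u v).
Proof.
rewrite [in RHS](coord_vbasis (memvf u)) linear_sumlz.
rewrite (eq_bigr _ (fun i _ => linearZl_LR _ _ _ _)) ext_vec_comb.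
apply: eq_bigr => i _.
rewrite [in RHS](coord_vbasis (memvf v)) linear_sumr.
rewrite (eq_bigr _ (fun i _ => linearZr_LR _ _ _ _)) ext_vec_comb scaler_sumr.
by apply: eq_bigr => j _; rewrite !mxE scalerA.
Qed.

Variable O : octonion_algebra k.

Definition V27T := subvs_of (V27 O).

(* The [R]-points of the group scheme $G = \mathrm{Aut}(\mathcal O)$. *)
Definition is_aut (g : {linear scalar_ext O -> scalar_ext O}) : Prop :=
  bijective g /\
  forall x y, g (ext_bil (omul O) x y) = ext_bil (omul O) (g x) (g y).

(* The action of an [R]-point on $W\otimes R$, which it leaves stable. *)
Definition aut_pure (g : scalar_ext O -> scalar_ext O)
    (w : scalar_ext (pure O)) : scalar_ext (pure O) :=
  ext_lin (vsproj (pureV O)) (g (ext_lin vsval w)).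

Definition operator (A : V27T) : pure O -> pure O := vsval (vsval A).

(* [x'] is the image of [x] under [g]. As [g] preserves [form], the action
   $g\cdot ab = (ga)(gb)$ on $\mathrm S^2 W$ is conjugation of operators:
   $x' = g x g^{-1}$. *)
Definition aut_image (g : scalar_ext O -> scalar_ext O)
    (x x' : scalar_ext V27T) : Prop :=
  forall w, ext_bil operator x' (aut_pure g w)
            = aut_pure g (ext_bil operator x w).

End BaseChange.

(* Equivariance for the algebraic group $G$, that is, for its points in all
   commutative [k]-algebras; [k] may be finite. *)
Definition equivariant (k : fieldType) (O : octonion_algebra k)
    (f : V27T O -> V27T O -> V27T O) : Prop :=
  forall (R : comAlgType k)
         (g : {linear scalar_ext R O -> scalar_ext R O}), is_aut g ->
  forall x y x' y', aut_image g x x' -> aut_image g y y' ->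
    aut_image g (ext_bil f x y) (ext_bil f x' y').

(* Main.v *)
From Pilot Require Import Defs.
From mathcomp Require Import all_boot all_order all_algebra.
From HB Require Import structures.
From mathcomp Require Import ring qpoly.

(** Infinitesimal automorphisms over the dual numbers turn equivariance into
    compatibility with the derivations of the Malcev algebra W.  Choose an
    orthogonal basis e_0, ..., e_6 of W made of octonion units: derivations
    rotate e_i towards e_j while fixing a third e_l.  Let f be commutative and
    equivariant, and let Q be the value of f on the traceless parts of e_0^2
    and e_1^2.  The derivations that kill e_0 and e_1 make Q scalar on
    e_3, ..., e_6 and orthogonal to the mixed terms; the rotation D of e_0
    towards e_1 satisfies D^3 Q = c D Q with a constant c that forces Q to be
    diagonal with equal normalized coefficients at e_0 and e_1.  As Q is
    traceless, it depends on two parameters only, and the two given products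
    are independent there.  An f with Q = 0 vanishes, as rotations move Q to
    all values of f on a spanning set.

    Conversely, over any commutative k-algebra, both products are expressed
    through composition of operators, Malcev multiplication and traces, all of
    which are preserved by automorphisms. *)

Set Implicit Arguments.
Unset Strict Implicit.
Unset Printing Implicit Defensive.

(* [Defs] is imported again since [all_algebra] shadows its [form]. *)
Import Pilot.Defs GRing.Theory.
Local Open Scope ring_scope.

(** * Composition and Malcev identities *)


(** The field may lack square roots and the octonions may form a division algebra, so neither
    orthonormal bases nor root vectors are at hand. Rotations in the planes of a non-normalized
    orthogonal basis replace root vectors, and the norms are carried through every formula. Rational
    points may say too little over a finite field, whence the dual numbers, which give access to the
    Lie algebra. The converse concerns arbitrary points of G: there an automorphism over a ring with
    zero divisors must first be shown to preserve the pairing. As [aut_image] relates operators and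
    not products ab, the defining formulas of the two products cannot be transported directly, which
    is why they are rewritten. The primes that must be invertible enter separately: 7 is the trace
    of the identity of W, 3 already occurs in the rotation that kills a third vector, and 5 occurs
    only in 15 = 16 - 1, where 16 is the numerical factor of c. *)

Lemma eq_of_subr (V : zmodType) (a b c d : V) : c = d -> a - b = c - d -> a = b.
Proof. by move=> -> /eqP; rewrite subrr subr_eq0 => /eqP. Qed.

Section Composition.

Variables (k : fieldType) (O : octonion_algebra k).
Local Notation N := (@onorm k O).
Local Notation "x ** y" := (omul O x y) (at level 40, left associativity).
Local Notation e := (oone O).

Lemma pairingDl (x y z : O) : pairing (x + y) z = pairing x z + pairing y z.
Proof. exact: linearDl. Qed.

Lemma pairingDr (x y z : O) : pairing z (x + y) = pairing z x + pairing z y.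
Proof. exact: linearDr. Qed.

Lemma pairingZl a (x y : O) : pairing (a *: x) y = a * pairing x y.
Proof. exact: linearZl_LR. Qed.

Lemma pairingZr a (x y : O) : pairing x (a *: y) = a * pairing x y.
Proof. exact: linearZr_LR. Qed.

Lemma pairingNl (x y : O) : pairing (- x) y = - pairing x y.
Proof. exact: linearNl. Qed.

Lemma pairingNr (x y : O) : pairing y (- x) = - pairing y x.
Proof. exact: linearNr. Qed.

Definition pairing_expand :=
  (pairingDl, pairingDr, pairingZl, pairingZr, pairingNl, pairingNr).

Lemma pairing_inj (x y : O) : (forall z, pairing x z = pairing y z) -> x = y.
Proof.
move=> xy; apply/eqP; rewrite -subr_eq0; apply/eqP; apply: onorm_nondegenerate => z.
by rewrite -[polar _ _ _]/(pairing (x - y) z) !pairing_expand xy subrr.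
Qed.

Lemma onormD (x y : O) : N (x + y) = pairing x y + N x + N y :> k.
Proof. by rewrite /pairing /polar; ring. Qed.

Lemma pairing_mul2l (x y z : O) : pairing (x ** y) (x ** z) = N x * pairing y z.
Proof.
have := onormM x (y + z); rewrite linearDr /= !onormD !onormM => E.
by apply: (addIr (N x * N y + N x * N z)); rewrite addrA E; ring.
Qed.

Lemma pairing_mul2r (x y z : O) : pairing (y ** x) (z ** x) = N x * pairing y z.
Proof.
have := onormM (y + z) x; rewrite linearDl /= !onormD !onormM => E.
by apply: (addIr (N y * N x + N z * N x)); rewrite addrA E; ring.
Qed.

(** Polarizing [pairing_mul2l] in [x] against the identity shows that the adjoint of left
    multiplication by [x] is left multiplication by the conjugate of [x]. *)
Lemma pairing_adjl (x y z : O) :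
  pairing (x ** y) z = pairing x e * pairing y z - pairing y (x ** z).
Proof.
have := pairing_mul2l (x + e) y z; rewrite !linearDl /= !omul1l !pairing_expand.
rewrite pairing_mul2l onormD (onorm1 O) => E.
(* [eq_of_subr] acts as a linear-combination step: the goal follows from [E] once the differences of
   their sides agree, which [ring] checks. *)
by apply: (eq_of_subr E); ring.
Qed.

Lemma pairing_adjr (x y z : O) :
  pairing (y ** x) z = pairing x e * pairing y z - pairing y (z ** x).
Proof.
have := pairing_mul2r (x + e) y z; rewrite !linearDr /= !omul1r !pairing_expand.
rewrite pairing_mul2r onormD (onorm1 O) => E.
by apply: (eq_of_subr E); ring.
Qed.

(** Left multiplication by [x] scales the pairing by N(x), so composing it with its adjoint,
    multiplication by the conjugate, gives the scalar N(x). This is the left alternative law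
    combined with the quadratic equation of [x]. *)
Lemma omulA_alt (x y : O) : x ** (x ** y) = pairing x e *: (x ** y) - N x *: y.
Proof.
apply: pairing_inj => z; rewrite pairing_adjl !pairing_expand.
by rewrite (pairingC y) pairing_mul2l (pairingC z); ring.
Qed.

Lemma omul_anticomm (x y : O) :
  x ** y + y ** x = pairing x e *: y + pairing y e *: x - pairing x y *: e.
Proof.
have sq (z : O) : z ** z = pairing z e *: z - N z *: e.
  by rewrite -{2}(omul1r z) omulA_alt omul1r.
have := sq (x + y); rewrite linearDl /= !linearDr /= !sq.
rewrite onormD pairing_expand => E.
apply: (eq_of_subr E); apply: pairing_inj => z; rewrite !pairing_expand; ring.
Qed.

End Composition.

(** * The double product identity and inner derivations of W *)

Section Malcev.

Variables (k : fieldType) (O : octonion_algebra k).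
Hypothesis k2 : 2%:R != 0 :> k.

Local Notation N := (@onorm k O).
Local Notation "x ** y" := (omul O x y) (at level 40, left associativity).
Local Notation e := (oone O).
Local Notation W := (pure O).
Local Notation "a ## b" := (malcev a b) (at level 40, left associativity).

Lemma formDl (x y z : W) : form (x + y) z = form x z + form y z.
Proof. exact: linearDl. Qed.

Lemma formDr (x y z : W) : form z (x + y) = form z x + form z y.
Proof. exact: linearDr. Qed.

Lemma formZl a (x y : W) : form (a *: x) y = a * form x y.
Proof. exact: linearZl_LR. Qed.

Lemma formZr a (x y : W) : form x (a *: y) = a * form x y.
Proof. exact: linearZr_LR. Qed.

Lemma formNl (x y : W) : form (- x) y = - form x y.
Proof. exact: linearNl. Qed.

Lemma formNr (x y : W) : form y (- x) = - form y x.
Proof. exact: linearNr. Qed.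

Lemma form0l (y : W) : form 0 y = 0.
Proof. exact: linear0l. Qed.

Lemma form0r (y : W) : form y 0 = 0.
Proof. exact: linear0r. Qed.

Definition form_expand :=
  (formDl, formDr, formZl, formZr, formNl, formNr, form0l, form0r).

Lemma malcevDl (x y z : W) : malcev (x + y) z = malcev x z + malcev y z.
Proof. exact: linearDl. Qed.

Lemma malcevDr (x y z : W) : malcev z (x + y) = malcev z x + malcev z y.
Proof. exact: linearDr. Qed.

Lemma malcevZl a (x y : W) : malcev (a *: x) y = a *: malcev x y.
Proof. exact: linearZl_LR. Qed.

Lemma malcevZr a (x y : W) : malcev x (a *: y) = a *: malcev x y.
Proof. exact: linearZr_LR. Qed.

Lemma malcevNl (x y : W) : malcev (- x) y = - malcev x y.
Proof. exact: linearNl. Qed.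

Lemma malcevNr (x y : W) : malcev y (- x) = - malcev y x.
Proof. exact: linearNr. Qed.

Lemma malcev0l (y : W) : malcev 0 y = 0.
Proof. exact: linear0l. Qed.

Lemma malcev0r (y : W) : malcev y 0 = 0.
Proof. exact: linear0r. Qed.

Definition malcev_expand :=
  (malcevDl, malcevDr, malcevZl, malcevZr, malcevNl, malcevNr, malcev0l, malcev0r).

(** Turns vector identities in W into scalar ones within reach of [ring]. *)
Lemma form_inj (x y : W) : (forall z, form x z = form y z) -> x = y.
Proof.
move=> xy; apply/eqP; rewrite -subr_eq0; apply/eqP.
by apply: (form_nondegenerate k2) => z; rewrite !form_expand xy subrr.
Qed.

Lemma pure_pairing1 (a : W) : pairing (vsval a) e = 0.
Proof. by apply/eqP; rewrite -mem_pureV subvsP. Qed.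

Lemma omul_pure (a b : W) :
  vsval a ** vsval b = 2%:R^-1 *: (vsval (a ## b) - form a b *: e).
Proof.
have := omul_anticomm (vsval a) (vsval b); rewrite !pure_pairing1 !scale0r !add0r.
move=> /(canRL (addKr _)) ba; rewrite val_malcev /commutator ba.
rewrite -[pairing _ _]/(form a b) opprD !opprK addrA addrK -mulr2n -scaler_nat scalerA.
by rewrite mulVf ?scale1r.
Qed.

Lemma malcevC (a b : W) : a ## b = - (b ## a).
Proof. by rewrite /malcev -linearN /= /commutator opprB. Qed.

Lemma malcevxx (a : W) : a ## a = 0.
Proof. by rewrite /malcev /commutator subrr linear0. Qed.

(** Left and right multiplications by pure octonions are skew-adjoint. Together with
    anticommutativity this makes [form (a ## b) c] an alternating trilinear form. *)
Lemma form_malcev (a b c : W) : form (a ## b) c = form a (b ## c).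
Proof.
rewrite /form !val_malcev /commutator !pairing_expand !pairing_adjl.
rewrite [pairing _ (vsval b ** _)]pairingC [pairing _ (vsval c ** _)]pairingC.
rewrite pairing_adjl (pairing_adjr (vsval b)) !pure_pairing1.
by rewrite (pairingC (vsval c)) (pairingC (vsval b) (vsval a ** _)) pairing_adjl pure_pairing1; ring.
Qed.

(** The double cross product identity in dimension 7. It is the alternative law for pure [a], since
    [a ## b] is 2ab plus a multiple of the identity. *)
Lemma malcev_malcev (a b : W) :
  a ## (a ## b) = (2%:R * form a b) *: a - (2%:R * form a a) *: b.
Proof.
have form_val (c d : W) : form c d = pairing (vsval c) (vsval d) by [].
have Naa : form a a = 2%:R * N (vsval a).
  by rewrite form_val /pairing /polar -mulr2n -scaler_nat onormZ; ring.
have mulE (c d : W) : vsval (c ## d) = 2%:R *: (vsval c ** vsval d) + form c d *: e.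
  by rewrite omul_pure scalerA mulfV // scale1r subrK.
apply: val_inj; rewrite !linearB !linearZ /= mulE -form_malcev malcevxx form0l.
rewrite scale0r addr0 mulE linearDr linearZr /= linearZr /= omul1r.
rewrite omulA_alt pure_pairing1 scale0r add0r Naa.
by rewrite scalerDr scalerN !scalerN !scalerA addrC mulrA.
Qed.

(** Linearization of [malcev_malcev]. As a rewrite rule it sorts the factors of a nested product, up
    to terms of lower degree. *)
Lemma malcev_swap (a b c : W) : a ## (b ## c) = - (b ## (a ## c))
  + (2%:R * form a c) *: b + (2%:R * form b c) *: a - (4%:R * form a b) *: c.
Proof.
have := malcev_malcev (a + b) c; rewrite !malcev_expand !malcev_malcev => E.
apply: (eq_of_subr E); apply: form_inj => w; rewrite !form_expand (formC b a); ring.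
Qed.

(** The standard inner derivation of a Malcev algebra, [L_a, L_b] plus the left multiplication by
    [a ## b]. In a Lie algebra it would be twice that multiplication. *)
Definition inner_der (a b c : W) : W := a ## (b ## c) - b ## (a ## c) + (a ## b) ## c.

Record pure_derivation (D : W -> W) : Prop := PureDerivation {
  der_linear : linear D;
  der_malcev : forall a b, D (a ## b) = D a ## b + a ## D b;
  der_skew : forall a b, form (D a) b = - form a (D b)
}.

Lemma form_malcev_cycle (a b c : W) : form (a ## b) c = form (b ## c) a.
Proof. by rewrite form_malcev formC. Qed.

Lemma inner_der_derivation a b : pure_derivation (inner_der a b).
Proof.
split=> [t c d|c d|c d]; first 1 last; last first.
- apply: form_inj => w; rewrite /inner_der !(malcev_expand, form_expand); ring.
- have fC (x y z : W) : form (x ## y) z = - form y (x ## z).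
    by rewrite malcevC form_expand form_malcev.
  by rewrite /inner_der !form_expand !fC; ring.
have sw := (malcev_swap b a, malcev_swap c a, malcev_swap d a,
            malcev_swap c b, malcev_swap d b, malcev_swap d c).
have an := (malcevC b a, malcevC c a, malcevC d a,
            malcevC c b, malcevC d b, malcevC d c).
have anl := (fun x y => malcevC (x ## y) a, fun x y => malcevC (x ## y) b,
  fun x y => malcevC (x ## y) c, fun x y => malcevC (x ## y) d).
have pp := (malcev_swap (c ## d) a b, malcev_swap (a ## b) c d).
(* The degree 4 monomials all equal $\pm a*(b*(c*d))$ up to terms of lower
   degree, while [rel] says that twice that monomial has lower degree. *)
have rel : (c ## d) ## (a ## b) + (a ## b) ## (c ## d) = 0 by rewrite malcevC addNr.
(* All values of the alternating trilinear form on [x], [y], [z] are brought to one atom up to sign,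
   so that the final [field] call sees a single unknown per triple. *)
have tri (x y z : W) : (form x (y ## z) = form (x ## y) z)
    * (form y (x ## z) = - form (x ## y) z) * (form z (x ## y) = form (x ## y) z)
    * (form (y ## z) x = form (x ## y) z) * (form (x ## z) y = - form (x ## y) z).
  have e1 (u v t : W) : form u (v ## t) = form (u ## v) t by rewrite form_malcev.
  have e2 : form (x ## z) y = - form (x ## y) z.
    by rewrite malcevC form_expand form_malcev_cycle.
  have e3 : form (y ## x) z = - form (x ## y) z by rewrite malcevC form_expand.
  by rewrite !e1 e2 e3 (form_malcev_cycle z x) -(form_malcev_cycle x y).
have tris := (tri a b c, tri a b d, tri a c d, tri b c d).
move: rel; rewrite /inner_der !(malcev_expand, pp, anl, sw, an) => rel.
apply: form_inj => w.
apply: (eq_of_subr (congr1 (fun v => 2%:R^-1 * form v w) rel)).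
rewrite !form_expand !tris (formC b a) (formC c b) (formC d b) (formC d c).
rewrite (formC c a) (formC d a).
by field.
Qed.
End Malcev.

(** * Orthogonal frames and rotations *)

Section Frame.

Variables (k : fieldType) (O : octonion_algebra k).
Hypothesis k2 : 2%:R != 0 :> k.
Local Notation W := (pure O).
Local Notation "a ## b" := (malcev a b) (at level 40, left associativity).

Lemma der_combination s t (D D' : W -> W) : pure_derivation D ->
  pure_derivation D' -> pure_derivation (fun c => s *: D c + t *: D' c).
Proof.
move=> [L M S] [L' M' S']; split=> [u c d|c d|c d].
- by rewrite L L'; apply: (form_inj k2) => w; rewrite !form_expand; ring.
- by rewrite M M'; apply: (form_inj k2) => w; rewrite !(form_expand, malcev_expand); ring.
- by rewrite !form_expand S S'; ring.
Qed.

Lemma der0 (D : W -> W) : pure_derivation D -> D 0 = 0.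
Proof. by move=> [L _ _]; have := L (-1) 0 0; rewrite scaler0 addr0 scaleN1r addNr. Qed.

Lemma derZ (D : W -> W) a x : pure_derivation D -> D (a *: x) = a *: D x.
Proof. by move=> Dd; have := der_linear Dd a x 0; rewrite (der0 Dd) !addr0. Qed.

Lemma derD (D : W -> W) x y : pure_derivation D -> D (x + y) = D x + D y.
Proof. by move=> Dd; have := der_linear Dd 1 x y; rewrite !scale1r. Qed.

Lemma form_malcevl (a b : W) : form a (a ## b) = 0.
Proof. by rewrite -form_malcev malcevxx form0l. Qed.

Lemma form_malcevr (a b : W) : form b (a ## b) = 0.
Proof. by rewrite (malcevC a) !form_expand form_malcevl oppr0. Qed.

Lemma malcev_orth (a b : W) : form a b = 0 -> a ## (a ## b) = - (2%:R * form a a) *: b.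
Proof. by move=> ab; rewrite (malcev_malcev k2) ab mulr0 scale0r sub0r scaleNr. Qed.

Lemma malcev_orthr (a b : W) : form a b = 0 -> b ## (a ## b) = (2%:R * form b b) *: a.
Proof.
move=> ab; rewrite (malcevC a) malcev_expand malcev_orth 1?formC //.
by rewrite scaleNr opprK.
Qed.

Lemma malcev_antiassoc (a b c : W) : form a b = 0 -> form a c = 0 -> form b c = 0 ->
  a ## (b ## c) = - (a ## b ## c).
Proof.
move=> ab ac bc; rewrite (malcevC b) malcev_expand (malcev_swap k2).
by rewrite ab ac (formC c) bc !mulr0 !scale0r !addr0 subr0 opprK malcevC.
Qed.

Lemma form_malcev_malcev (a b c : W) : form (a ## b) (a ## c)
  = 2%:R * form a a * form b c - 2%:R * form a b * form a c.
Proof.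
rewrite (malcevC a b) form_expand form_malcev (malcev_malcev k2).
by rewrite !form_expand (formC b a); ring.
Qed.

Section InnerOrthogonal.

Variables a b c : W.
Hypothesis ab : form a b = 0.

Lemma inner_der_l : inner_der a b a = (4%:R * form a a) *: b.
Proof.
rewrite /inner_der malcevxx malcev_expand subr0 (malcevC b) (malcevC _ a) !malcev_expand.
by rewrite malcev_orth //; apply: (form_inj k2) => w; rewrite !form_expand; ring.
Qed.

Lemma inner_der_r : inner_der a b b = - (4%:R * form b b) *: a.
Proof.
rewrite /inner_der malcevxx malcev_expand sub0r (malcevC a) !malcev_expand (malcevC _ b).
rewrite malcev_orth 1?formC //; apply: (form_inj k2) => w; rewrite !form_expand; ring.
Qed.

Lemma inner_der_lr : inner_der a b (a ## b) = 0.
Proof.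
by rewrite /inner_der malcev_orthr // malcev_orth // !malcev_expand !malcevxx !scaler0 subr0 addr0.
Qed.

(** By anti-associativity the three terms of [inner_der] are -1, -1 and +1 times [a ## b ## c]. *)
Lemma inner_der_orth : form a c = 0 -> form b c = 0 -> inner_der a b c = - (a ## b ## c).
Proof.
move=> ac bc; rewrite /inner_der !malcev_antiassoc // 1?(formC b) //.
by rewrite (malcevC b a) malcev_expand opprK; apply: (form_inj k2) => w;
  rewrite !form_expand; ring.
Qed.

End InnerOrthogonal.

(** The inner derivation of [x] and [z] rotates their plane and kills [x ## z], which settles the
    second alternative. In the first one it sends [y] to [- (x ## z ## y)] and must be corrected by
    a second inner derivation. *)
Lemma rotation x y z (t : k) : form x y = 0 -> form x z = 0 -> form y z = 0 ->
    3%:R != 0 :> k -> form x x != 0 -> form y y != 0 -> form z z != 0 ->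
    form y (x ## z) = 0 \/ y = t *: (x ## z) ->
  exists D : W -> W, exists s, [/\ pure_derivation D, s != 0,
    D x = (s * form x x) *: z, D z = - (s * form z z) *: x & D y = 0].
Proof.
move=> xy xz yz k3 nx ny nz.
have k4 : 4%:R != 0 :> k by rewrite (natrM _ 2 2) mulf_neq0.
case=> [ym | ->]; last first.
  exists (inner_der x z), 4%:R; split=> //; first exact: inner_der_derivation.
  - exact: inner_der_l.
  - exact: inner_der_r.
  - by rewrite (derZ _ _ (inner_der_derivation k2 _ _)) inner_der_lr // scaler0.
pose w := x ## y; pose m := x ## z.
have wx : form w x = 0 by rewrite formC form_malcevl.
have wy : form w y = 0 by rewrite formC form_malcevr.
have mx : form m x = 0 by rewrite formC form_malcevl.
have mz : form m z = 0 by rewrite formC form_malcevr.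
have wz : form w z = 0.
  by rewrite /w (malcevC x) form_expand form_malcev ym oppr0.
have wm : form w m = 0 by rewrite /w /m form_malcev_malcev xy xz yz !mulr0 subr0.
have nw : form w w = 2%:R * form x x * form y y.
  by rewrite form_malcev_malcev xy; ring.
have wmw : w ## (m ## w) = (2%:R * form w w) *: m.
  by rewrite (malcevC m) malcev_expand malcev_orth // scaleNr opprK.
have wmw0 : form w (m ## w) = 0 by rewrite form_malcevr.
have mxE : m ## x = (2%:R * form x x) *: z.
  by rewrite malcevC /m malcev_orth // scaleNr opprK.
have mzE : m ## z = - (2%:R * form z z) *: x.
  by rewrite malcevC /m (malcevC x) malcev_expand opprK malcev_orth // formC.
have myw : form (m ## w) y = 0.
  rewrite form_malcev /w (malcevC _ y) (malcevC x) malcev_expand opprK malcev_orth 1?formC //.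
  by rewrite form_expand formC mx mulr0.
have mwx : form (m ## w) x = 0.
  by rewrite (malcevC m) form_expand form_malcev mxE form_expand wz mulr0 oppr0.
have mwz : form (m ## w) z = 0.
  by rewrite (malcevC m) form_expand form_malcev mzE form_expand wx mulr0 oppr0.
(* Both [w] and [m ## w] are orthogonal to [x], [y], [z], and [w ## (m ## w)] is a multiple of [m].
   Their inner derivation therefore acts on these three vectors as a multiple of the product with
   [m], and the scalar is chosen to cancel the motion of [y]. On [x] the two contributions add up to
   8 + 4 = 12, whence the need for 3 to be invertible. *)
exists (fun c => (2%:R * form w w) *: inner_der x z c + (-1) *: inner_der w (m ## w) c).
exists (12%:R * form w w); split.
- by apply: der_combination; apply: inner_der_derivation.
- by rewrite nw (natrM _ 4 3) !mulf_neq0.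
- rewrite inner_der_l // inner_der_orth // wmw malcev_expand mxE.
  by apply: (form_inj k2) => v; rewrite !form_expand; ring.
- rewrite inner_der_r // inner_der_orth // wmw malcev_expand mzE.
  by apply: (form_inj k2) => v; rewrite !form_expand; ring.
- rewrite !inner_der_orth // 1?formC // wmw malcev_expand -/m.
  by apply: (form_inj k2) => v; rewrite !form_expand; ring.
Qed.

Lemma dim_pure : \dim {: pure O} = 7.
Proof.
rewrite dimvf /dim /=; have := limg_ker_dim (linfun (@pairing_one k O)) fullv.
rewrite capfv odim -/(pureV O) => E.
suff : \dim (limg (linfun (@pairing_one k O))) = 1%N by move=> i1; move: E; rewrite i1 addn1 => -[].
apply/eqP; rewrite eqn_leq; apply/andP; split.
  by apply: leq_trans (dimvS (subvf _)) _; rewrite dimvf.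
rewrite lt0n dimv_eq0; apply/eqP => i0.
have : linfun (@pairing_one k O) (oone O) \in limg (linfun (@pairing_one k O)).
  exact: memv_img (memvf _).
by rewrite i0 memv0 lfunE /= /pairing_one pairing11 (negPf k2).
Qed.

Lemma form_neq0 (u : W) : u != 0 -> exists b, form u b != 0.
Proof.
move=> u0; have [/existsP[i ui]|/existsPn u_orth] :=
  boolP [exists i, form u (pbase i) != 0]; first by exists (pbase i).
case/eqP: u0; apply: (form_nondegenerate k2) => b.
rewrite (sum_pbase b) linear_sumr big1 // => i _; rewrite linearZr_LR /=.
by have /negPn/eqP -> := u_orth i; rewrite mulr0.
Qed.

(** * Orthogonal bases and the multiplication table of a frame *)

Definition form_row r (s : 'I_r -> W) (v : W) : 'rV[k]_r := \row_i form (s i) v.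

Fact form_row_linear r (s : 'I_r -> W) : linear (form_row s).
Proof. by move=> a u v; apply/rowP => i; rewrite !mxE !form_expand. Qed.

HB.instance Definition _ r (s : 'I_r -> W) :=
  GRing.isLinear.Build k W 'rV[k]_r _ (form_row s) (form_row_linear s).

Section Orthogonal.

Variables (r : nat) (s : 'I_r -> W).
Hypothesis sn : forall i, form (s i) (s i) != 0.
Hypothesis so : forall i j, i != j -> form (s i) (s j) = 0.

Lemma form_orth_comb (c : 'I_r -> k) j :
  form (s j) (\sum_i c i *: s i) = c j * form (s j) (s j).
Proof.
rewrite linear_sumr (bigD1 j) //= linearZr_LR /= big1 ?addr0 // => i ij.
by rewrite linearZr_LR /= so ?mulr0 // eq_sym.
Qed.

(** Gram-Schmidt in the possible presence of isotropic vectors. The complement [U] is nonzero by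
    dimension and nondegenerate; if two vectors of [U] are isotropic but not orthogonal to each
    other, their sum is anisotropic. *)
Lemma exists_anisotropic_orth : (r < 7)%N ->
  exists2 v, form v v != 0 & forall i, form (s i) v = 0.
Proof.
move=> r7; pose U := lker (linfun (form_row s)).
have memU v : reflect (forall i, form (s i) v = 0) (v \in U).
  rewrite memv_ker lfunE; apply: (iffP eqP) => [/rowP v0 i | v0].
    by have := v0 i; rewrite !mxE.
  by apply/rowP => i; rewrite !mxE v0.
have U0 : U != 0%VS.
  apply/eqP => U0; have := limg_ker_dim (linfun (form_row s)) fullv.
  rewrite capfv -/U U0 dimv0 add0n dim_pure => d7.
  have := dimvS (subvf (limg (linfun (form_row s)))).
  by rewrite d7 dimvf /dim /= mul1n leqNgt r7.
pose u := vpick U; have u0 : u != 0 by rewrite vpick0.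
have uU : forall i, form (s i) u = 0 by apply/memU; exact: memv_pick.
have [b ub] := form_neq0 u0.
pose b' := b - \sum_i (form (s i) b / form (s i) (s i)) *: s i.
have bU i : form (s i) b' = 0.
  by rewrite !form_expand form_orth_comb divfK // subrr.
have ub' : form u b' = form u b.
  rewrite !form_expand linear_sumr big1 ?subr0 // => i _.
  by rewrite linearZr_LR /= (formC u) uU mulr0.
clearbody b'; have [uu|] := eqVneq (form u u) 0; last by exists u.
have [bb|] := eqVneq (form b' b') 0; last by exists b'.
exists (u + b') => [|i]; last by rewrite form_expand uU bU addr0.
rewrite !form_expand uu bb (formC b') add0r addr0 ub' -mulr2n -mulr_natl.
by rewrite mulf_neq0.
Qed.

Lemma orth_expansion : r = 7 ->
  forall w, w = \sum_i (form (s i) w / form (s i) (s i)) *: s i.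
Proof.
move=> r7 w; pose t := [tuple s i | i < r].
have tE (i : 'I_r) : t`_i = s i by rewrite -tnth_nth tnth_mktuple.
have t_free : free t.
  apply/freeP => c c0 i; apply: (mulIf (sn i)); rewrite mul0r -form_orth_comb.
  by rewrite -(form0r (s i)) -[in RHS]c0; congr form; apply: eq_bigr => j _; rewrite tE.
have t_basis : basis_of fullv t.
  by rewrite basisEfree t_free subvf size_tuple dim_pure r7.
have wE := coord_basis t_basis (memvf w).
rewrite {1}wE; apply: eq_bigr => i _; rewrite tE; congr (_ *: _).
have -> : form (s i) w = coord t i w * form (s i) (s i).
  rewrite {1}wE -(form_orth_comb (fun i => coord t i w)).
  by congr form; apply: eq_bigr => j _; rewrite tE.
by rewrite mulfK.
Qed.

End Orthogonal.

(** The first three vectors span the pure part of a quaternion subalgebra and the other four its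
    complement; the last clause of [frame_malcev] records the grading of the Cayley-Dickson
    doubling. The scalars [c] absorb norms that cannot be normalized. [frame_line] has no such
    scalar, which ties the norm of the third vector to those of the first two. *)
Record g2_frame (e : 'I_7 -> W) : Prop := G2Frame {
  frame_norm : forall i, form (e i) (e i) != 0;
  frame_orth : forall i j, i != j -> form (e i) (e j) = 0;
  frame_malcev : forall i j, i != j -> exists l c, [/\ c != 0,
    e i ## e j = c *: e l, l != i, l != j & (3 <= i -> 3 <= j -> l < 3)%N];
  frame_line : e (inord 0) ## e (inord 1) = e (inord 2)
}.

Local Notation o i := (@Ordinal 7 i isT).

(** Cayley-Dickson doubling: only [x], [y], [z] are chosen, and the other four vectors are products
    of these. The whole table then follows from the double product identity and from
    anti-associativity on orthogonal triples. *)
Lemma exists_frame : exists e, g2_frame e.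
Proof.
have [x nx _] := @exists_anisotropic_orth 0 (fun _ => 0)
  (fun i => match notF (ltn_ord i) with end) (fun i => match notF (ltn_ord i) with end) isT.
have [y ny /(_ ord0) xy] := @exists_anisotropic_orth 1 (fun _ => x)
  (fun _ => nx) (fun i j ij => False_ind _ (negP ij (introT eqP (etrans (ord1 i) (esym (ord1 j)))))) isT.
pose h := x ## y.
have hx : form x h = 0 by rewrite form_malcevl.
have hy : form y h = 0 by rewrite form_malcevr.
have nhE : form h h = 2%:R * form x x * form y y.
  by rewrite form_malcev_malcev xy; ring.
have nh : form h h != 0 by rewrite nhE !mulf_neq0.
have [z nz zs] : exists2 z, form z z != 0
    & [/\ form x z = 0, form y z = 0 & form h z = 0].
  have [||//|z nz zs] := @exists_anisotropic_orth 3 (fun i => nth 0 [:: x; y; h] i).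
  - by case=> [[|[|[|]]] ].
  - by case=> [[|[|[|]]] //= ?] [[|[|[|]]] //= ?] _; rewrite // formC.
  by exists z => //; split; [apply: (zs 0) | apply: (zs 1) | exact: (zs (@Ordinal 3 2 isT))].
case: zs => xz yz hz; have zx := etrans (formC z x) xz.
pose p := x ## z; pose q := y ## z; pose r := h ## z.
have px : form x p = 0 by rewrite form_malcevl.
have pz : form z p = 0 by rewrite form_malcevr.
have qy : form y q = 0 by rewrite form_malcevl.
have qz : form z q = 0 by rewrite form_malcevr.
have rh : form h r = 0 by rewrite form_malcevl.
have rz : form z r = 0 by rewrite form_malcevr.
have hE : y ## x = - h by rewrite malcevC.
have xh : x ## h = - (2%:R * form x x) *: y by rewrite malcev_orth.
have yh : y ## h = (2%:R * form y y) *: x.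
  by rewrite malcev_orthr.
have xp : x ## p = - (2%:R * form x x) *: z by rewrite malcev_orth.
have zp : z ## p = (2%:R * form z z) *: x by rewrite malcev_orthr.
have yq : y ## q = - (2%:R * form y y) *: z by rewrite malcev_orth.
have zq : z ## q = (2%:R * form z z) *: y by rewrite malcev_orthr.
have hr : h ## r = - (2%:R * form h h) *: z by rewrite malcev_orth.
have zr : z ## r = (2%:R * form z z) *: h by rewrite malcev_orthr.
have xq : x ## q = - 1 *: r by rewrite malcev_antiassoc // scaleN1r.
have yp : y ## p = r.
  by rewrite malcev_antiassoc // 1?formC // hE malcev_expand opprK.
have xr : x ## r = (2%:R * form x x) *: q.
  by rewrite malcev_antiassoc // xh malcev_expand scaleNr opprK.
have hp : h ## p = - (2%:R * form x x) *: q.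
  rewrite malcev_antiassoc // 1?formC // (malcevC h x) xh !malcev_expand.
  by rewrite opprK.
have yr : y ## r = - (2%:R * form y y) *: p.
  by rewrite malcev_antiassoc // yh malcev_expand scaleNr.
have hq : h ## q = (2%:R * form y y) *: p.
  by rewrite malcev_antiassoc // 1?formC // (malcevC h y) yh !malcev_expand opprK.
have yp0 : form y p = 0.
  by rewrite -form_malcev hE form_expand hz oppr0.
have xq0 : form x q = 0 by rewrite -form_malcev.
have pq : p ## q = - (2%:R * form z z) *: h.
  rewrite malcev_antiassoc // 1?formC // (malcevC p y) yp malcev_expand opprK.
  by rewrite (malcevC r) zr scaleNr.
have hp0 : form h p = 0 by rewrite -form_malcev (malcevC h) xh !form_expand yz mulr0 oppr0.
have hq0 : form h q = 0 by rewrite -form_malcev (malcevC h) yh !form_expand xz mulr0 oppr0.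
have pr : p ## r = (2%:R * form x x * (2%:R * form z z)) *: y.
  rewrite malcev_antiassoc // 1?formC // (malcevC p h) hp !malcev_expand opprK.
  by rewrite (malcevC q) zq scalerN scaleNr opprK scalerA.
have qr : q ## r = - (2%:R * form y y * (2%:R * form z z)) *: x.
  rewrite malcev_antiassoc // 1?formC // (malcevC q h) hq !malcev_expand opprK.
  by rewrite (malcevC p) zp scalerN scalerA scaleNr.
have xr0 : form x r = 0 by rewrite -form_malcev xh form_expand yz mulr0.
have yr0 : form y r = 0 by rewrite -form_malcev yh form_expand xz mulr0.
have pq0 : form p q = 0.
  by rewrite form_malcev zq form_expand xy mulr0.
have pr0 : form p r = 0 by rewrite form_malcev zr form_expand hx mulr0.
have qr0 : form q r = 0 by rewrite form_malcev zr form_expand hy mulr0.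
have np : form p p != 0.
  by rewrite form_malcev zp form_expand !mulf_neq0.
have nq : form q q != 0.
  by rewrite form_malcev zq form_expand !mulf_neq0.
have nr : form r r != 0.
  by rewrite form_malcev zr form_expand !mulf_neq0.
pose e (i : 'I_7) := nth 0 [:: x; y; h; z; p; q; r] i.
have wlog_lt (P : 'I_7 -> 'I_7 -> Prop) : (forall i j, P i j -> P j i) ->
    (forall i j : 'I_7, (i < j)%N -> P i j) -> forall i j, i != j -> P i j.
  move=> Psym Plt i j; rewrite neq_ltn => /orP[/Plt //|/Plt]; exact: Psym.
exists e; split.
- by case=> [[|[|[|[|[|[|[|]]]]]]] ].
- apply: wlog_lt => [i j|]; first by rewrite formC.
  by case=> [[|[|[|[|[|[|[|?]]]]]]] ?] [[|[|[|[|[|[|[|?]]]]]]] ?].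
- apply: wlog_lt => [i j [l [c [c0 eij li lj l3]]]|].
    exists l, (- c); split; rewrite ?oppr_eq0 //; first by rewrite malcevC eij scaleNr.
    by move=> j3 i3; apply: l3.
  have cE := (oppr_eq0, mulf_eq0, oner_eq0, negPf k2, negPf nx, negPf ny, negPf nz, negPf nh).
  have E (i j : 'I_7) l c : c != 0 -> e i ## e j = c *: e l -> l != i -> l != j ->
      (3 <= i -> 3 <= j -> l < 3)%N ->
    exists l' c', [/\ c' != 0, e i ## e j = c' *: e l', l' != i, l' != j
      & (3 <= i -> 3 <= j -> l' < 3)%N] by move=> *; exists l, c.
  case=> [[|[|[|[|[|[|[|?]]]]]]] ?] [[|[|[|[|[|[|[|?]]]]]]] ?] //= _.
  (* The 21 pairs [i < j] come in lexicographic order; each line gives the index of the third unit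
     and its coefficient in the product. *)
  + by apply: (E _ _ (o 2) (1)); rewrite ?(scale1r, cE) //.
  + by apply: (E _ _ (o 1) (- (2%:R * form x x))); rewrite ?(scale1r, cE) //.
  + by apply: (E _ _ (o 4) (1)); rewrite ?(scale1r, cE) //.
  + by apply: (E _ _ (o 3) (- (2%:R * form x x))); rewrite ?(scale1r, cE) //.
  + by apply: (E _ _ (o 6) (- 1)); rewrite ?(scale1r, cE) //.
  + by apply: (E _ _ (o 5) (2%:R * form x x)); rewrite ?(scale1r, cE) //.
  + by apply: (E _ _ (o 0) (2%:R * form y y)); rewrite ?(scale1r, cE) //.
  + by apply: (E _ _ (o 5) (1)); rewrite ?(scale1r, cE) //.
  + by apply: (E _ _ (o 6) (1)); rewrite ?(scale1r, cE) //.
  + by apply: (E _ _ (o 3) (- (2%:R * form y y))); rewrite ?(scale1r, cE) //.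
  + by apply: (E _ _ (o 4) (- (2%:R * form y y))); rewrite ?(scale1r, cE) //.
  + by apply: (E _ _ (o 6) (1)); rewrite ?(scale1r, cE) //.
  + by apply: (E _ _ (o 5) (- (2%:R * form x x))); rewrite ?(scale1r, cE) //.
  + by apply: (E _ _ (o 4) (2%:R * form y y)); rewrite ?(scale1r, cE) //.
  + by apply: (E _ _ (o 3) (- (2%:R * form h h))); rewrite ?(scale1r, cE) //.
  + by apply: (E _ _ (o 0) (2%:R * form z z)); rewrite ?(scale1r, cE) //.
  + by apply: (E _ _ (o 1) (2%:R * form z z)); rewrite ?(scale1r, cE) //.
  + by apply: (E _ _ (o 2) (2%:R * form z z)); rewrite ?(scale1r, cE) //.
  + by apply: (E _ _ (o 2) (- (2%:R * form z z))); rewrite ?(scale1r, cE) //.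
  + by apply: (E _ _ (o 1) (2%:R * form x x * (2%:R * form z z))); rewrite ?(scale1r, cE) //.
  + by apply: (E _ _ (o 0) (- (2%:R * form y y * (2%:R * form z z)))); rewrite ?(scale1r, cE) //.
- by rewrite /e !inordK.
Qed.

Section FrameRotations.

Variable e : 'I_7 -> W.
Hypothesis fe : g2_frame e.
Hypothesis k3 : 3%:R != 0 :> k.

(** The alternative required by [rotation] holds because [e i ## e j] is a multiple of a single
    frame vector, which is either [e l] or orthogonal to it. *)
Lemma frame_rotation (i j l : 'I_7) : i != j -> i != l -> j != l ->
  exists D s, [/\ pure_derivation D, s != 0,
    D (e i) = (s * form (e i) (e i)) *: e j,
    D (e j) = - (s * form (e j) (e j)) *: e i & D (e l) = 0].
Proof.
move=> ij il jl; have [t [c [c0 eij _ _ _]]] := frame_malcev fe ij.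
have o := frame_orth fe; have n := frame_norm fe.
apply: (@rotation _ (e l) _ c^-1); rewrite ?n //; try by rewrite o // eq_sym.
have [<-|lt] := eqVneq t l; first by right; rewrite eij scalerA mulVf // scale1r.
by left; rewrite eij form_expand o ?mulr0 // eq_sym.
Qed.

Let i0 : 'I_7 := inord 0.
Let i1 : 'I_7 := inord 1.
Let i2 : 'I_7 := inord 2.

Lemma ord7_lt3 (i : 'I_7) : (i < 3)%N -> i = i0 \/ i = i1 \/ i = i2.
Proof.
case: i => [[|[|[|]]] Hm] // _; [left|right; left|right; right];
  by apply: val_inj; rewrite /= inordK.
Qed.

(** A rotation of [e i] towards [e j] kills their product, a multiple of some [e t] with [t < 3].
    Choosing the fixed index [l < 3] different from [t] makes it kill two of the first three
    vectors, hence also the remaining one, a multiple of their product. *)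
Lemma frame_rotation3 (i j : 'I_7) : i != j -> (3 <= i)%N -> (3 <= j)%N ->
  exists D s, [/\ pure_derivation D, s != 0,
    D (e i) = (s * form (e i) (e i)) *: e j,
    D (e j) = - (s * form (e j) (e j)) *: e i & forall l : 'I_7, (l < 3)%N -> D (e l) = 0].
Proof.
move=> ij i3 j3; have [t [c [c0 eij _ _ /(_ i3 j3) t3]]] := frame_malcev fe ij.
pose l : 'I_7 := if t == i0 then i1 else i0.
have l3 : (l < 3)%N by rewrite /l; case: ifP; rewrite inordK.
have ne m : (2 < m)%N -> forall l' : 'I_7, (l' < 3)%N -> m != l' :> nat.
  by move=> m3 l' l'3; apply: contraTneq m3 => ->; rewrite -leqNgt.
have [D [s [Dd s0 Di Dj Dl]]] := frame_rotation ij (ne _ i3 _ l3) (ne _ j3 _ l3).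
exists D, s; split=> //.
have Dt : D (e t) = 0.
  have : D (e i ## e j) = 0.
    by rewrite (der_malcev Dd) Di Dj !malcev_expand !malcevxx !scaler0 addr0.
  by rewrite eij (derZ _ _ Dd) => /eqP; rewrite scaler_eq0 (negPf c0) => /eqP.
have o := frame_orth fe; have n := frame_norm fe.
have o01 : form (e i0) (e i1) = 0 by rewrite o // -(inj_eq val_inj) /= !inordK.
have D012 : D (e i0) = 0 -> D (e i1) = 0 -> D (e i2) = 0.
  by move=> D0 D1; rewrite -(frame_line fe) (der_malcev Dd) D0 D1 !malcev_expand addr0.
have D021 : D (e i0) = 0 -> D (e i2) = 0 -> D (e i1) = 0.
  move=> D0 D2; have := malcev_orth o01; rewrite (frame_line fe) => /(congr1 D).
  rewrite (der_malcev Dd) D0 D2 !malcev_expand addr0 (derZ _ _ Dd) => /esym/eqP.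
  by rewrite scaler_eq0 oppr_eq0 !mulf_eq0 (negPf k2) (negPf (n _)) => /eqP.
have D120 : D (e i1) = 0 -> D (e i2) = 0 -> D (e i0) = 0.
  move=> D1 D2; have := malcev_orthr o01; rewrite (frame_line fe) => /(congr1 D).
  rewrite (der_malcev Dd) D1 D2 !malcev_expand addr0 (derZ _ _ Dd) => /esym/eqP.
  by rewrite scaler_eq0 !mulf_eq0 (negPf k2) (negPf (n _)) => /eqP.
have [D0 D1 D2] : [/\ D (e i0) = 0, D (e i1) = 0 & D (e i2) = 0].
  move: Dl; rewrite /l; case: eqP => [t0 D1|/eqP t0 D0].
    by move: Dt; rewrite t0 => D0; split=> //; apply: D012.
  have [t1|t1] := eqVneq t i1.
    by move: Dt; rewrite t1 => D1; split=> //; apply: D012.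
  have t2 : t = i2.
    apply/val_inj; rewrite /= inordK //; move: t0 t1; rewrite -!(inj_eq val_inj) /= !inordK //.
    by case: (nat_of_ord t) t3 => [|[|[|]]].
  by move: Dt; rewrite t2 => D2; split=> //; apply: D021.
by move=> m /ord7_lt3[->|[->|->]].
Qed.

End FrameRotations.

End Frame.

(** * Vanishing of equivariant products *)

Section TracelessOperators.

Variables (k : fieldType) (O : octonion_algebra k).
Hypotheses (k2 : 2%:R != 0 :> k) (k7 : 7%:R != 0 :> k).
Local Notation W := (pure O).
Local Notation V := (V27T O).
Local Notation "a ## b" := (malcev a b) (at level 40, left associativity).

Lemma contract_S2id : contract (S2id O) = 7%:R.
Proof.
rewrite /contract (eq_bigr (fun=> 1)) => [|i _]; last first.
  by rewrite val_S2id // id_lfunE form_pdual // eqxx.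
by rewrite sumr_const card_ord dim_pure.
Qed.

Definition traceless (a b : W) : V :=
  vsproj (V27 O) (sym a b - (form a b / 7%:R) *: S2id O).

Lemma val_traceless a b :
  vsval (traceless a b) = sym a b - (form a b / 7%:R) *: S2id O.
Proof.
apply: vsprojK; rewrite memv_ker lfunE /= linearB linearZ /= contractE //.
by rewrite contract_S2id [_ *: _]divfK // subrr.
Qed.

Lemma tracelessC a b : traceless a b = traceless b a.
Proof. by rewrite /traceless symC formC. Qed.

Fact traceless_linearl b : linear (traceless^~ b).
Proof.
move=> t u v; rewrite /traceless -linearP sym_linearl form_linearl.
congr vsproj; rewrite mulrDl scalerDl opprD addrACA -mulrA -[in LHS]scalerA.
by rewrite -scalerBr.
Qed.

Fact traceless_linearr a : linear (traceless a).
Proof. by move=> t u v; rewrite !(tracelessC a) traceless_linearl. Qed.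

HB.instance Definition _ := bilinear_isBilinear.Build k W W V _ _ traceless
  (traceless_linearl, traceless_linearr).

Lemma operator_traceless a b w :
  operator (traceless a b) w = symop a b w - (form a b / 7%:R) *: w.
Proof.
rewrite /operator val_traceless -scaleNr linearD linearZ /= val_sym val_S2id //.
by rewrite add_lfunE scale_lfunE id_lfunE scaleNr.
Qed.

Lemma operator_inj (x y : V) : (forall w, operator x w = operator y w) -> x = y.
Proof. by move=> xy; do 2!apply: val_inj; apply/lfunP. Qed.

Lemma operatorD (x y : V) w : operator (x + y) w = operator x w + operator y w.
Proof. by rewrite /operator !linearD /= add_lfunE. Qed.

Lemma operatorZ a (x : V) w : operator (a *: x) w = a *: operator x w.
Proof. by rewrite /operator !linearZ /= scale_lfunE. Qed.

Lemma operator_self (x : V) u w : form (operator x u) w = form u (operator x w).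
Proof. exact: ((mem_S2V k2 _).1 (subvsP _)). Qed.

Definition matrix_coef (x : V) (u w : W) : k^o := form (operator x u) w.

Lemma matrix_coefC x u w : matrix_coef x u w = matrix_coef x w u.
Proof. by rewrite /matrix_coef operator_self formC. Qed.

(** Writing [x] as a sum of products through dual bases, the scalar corrections hidden in
    [traceless] add up to a multiple of the trace of [x], which is zero. *)
Lemma traceless_span (M : lmodType k) (phi : {linear V -> M}) :
  (forall a b, phi (traceless a b) = 0) -> forall x, phi x = 0.
Proof.
move=> phi0 x; suff -> : x = \sum_i traceless (operator x (pdual i)) (pbase i).
  by rewrite linear_sum big1.
apply: val_inj; rewrite linear_sum /= {1}(S2_sum_sym k2 (vsval x)).
rewrite (eq_bigr _ (fun i _ => val_traceless _ _)) sumrB -scaler_suml -mulr_suml.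
have := subvsP x; rewrite memv_ker lfunE /= /contract => /eqP.
by rewrite /operator => ->; rewrite mul0r scale0r subr0.
Qed.

(** The Lie algebra action, by commutators of operators. It is a relation, parallel to [aut_image],
    so that the commutator need not be shown beforehand to lie in [V]. *)
Definition der_image (D : W -> W) (x x' : V) :=
  forall w, operator x' w = D (operator x w) - operator x (D w).

Definition inf_equivariant (f : V -> V -> V) := forall D, pure_derivation D ->
  forall x x' y y', der_image D x x' -> der_image D y y' ->
  der_image D (f x y) (f x' y + f x y').

Section Derivation.

Variable D : W -> W.
Hypothesis Dd : pure_derivation D.

Lemma der_image_traceless a b :
  der_image D (traceless a b) (traceless (D a) b + traceless a (D b)).
Proof.
move=> w; rewrite operatorD !operator_traceless !symopE.
have DN x : D (- x) = - D x by rewrite -scaleN1r (derZ _ _ Dd) scaleN1r.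
rewrite !(derD _ _ Dd) DN !(derZ _ _ Dd) !(derD _ _ Dd) !(derZ _ _ Dd).
have sk x y : form x (D y) = - form (D x) y by rewrite (der_skew Dd) opprK.
apply: (form_inj k2) => v; rewrite !form_expand !sk; ring.
Qed.

Lemma der_image0 z : der_image D 0 z -> z = 0.
Proof.
have z0 w : operator (0 : V) w = 0 by rewrite -(scale0r (0 : V)) operatorZ scale0r.
by move=> z_im; apply: operator_inj => w; rewrite z_im !z0 (der0 Dd) subr0.
Qed.

Lemma der_imageZ t x x' : der_image D x x' -> der_image D (t *: x) (t *: x').
Proof.
by move=> xx' w; rewrite !operatorZ xx' (derZ _ _ Dd) scalerBr.
Qed.

Lemma der_imageD x x' y y' : der_image D x x' -> der_image D y y' ->
  der_image D (x + y) (x' + y').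
Proof.
move=> xx' yy' w; rewrite !operatorD xx' yy' (derD _ _ Dd) opprD.
by rewrite addrACA.
Qed.

Lemma der_image_coef x x' u w : der_image D x x' ->
  matrix_coef x' u w = - matrix_coef x (D u) w - matrix_coef x u (D w).
Proof.
move=> xx'; rewrite /matrix_coef xx' !form_expand (der_skew Dd).
by rewrite addrC.
Qed.

End Derivation.

Lemma matrix_coefD x y u w : matrix_coef (x + y) u w = matrix_coef x u w + matrix_coef y u w.
Proof. by rewrite /matrix_coef operatorD form_expand. Qed.

Lemma matrix_coefZ t x u w : matrix_coef (t *: x) u w = t * matrix_coef x u w.
Proof. by rewrite /matrix_coef operatorZ form_expand. Qed.

Lemma matrix_coefZl t x u w : matrix_coef x (t *: u) w = t * matrix_coef x u w.
Proof. by rewrite /matrix_coef /operator linearZ form_expand. Qed.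

Lemma matrix_coefZr t x u w : matrix_coef x u (t *: w) = t * matrix_coef x u w.
Proof. by rewrite /matrix_coef form_expand. Qed.

Lemma matrix_coef0l x w : matrix_coef x 0 w = 0.
Proof. by rewrite -(scale0r (0 : W)) matrix_coefZl mul0r. Qed.

Lemma matrix_coef0r x w : matrix_coef x w 0 = 0.
Proof. by rewrite matrix_coefC matrix_coef0l. Qed.

Definition matrix_coef_expand := (matrix_coefD, matrix_coefZ, matrix_coefZl,
  matrix_coefZr, matrix_coef0l, matrix_coef0r).

(** * Propagation of zeros and the coefficients of Q *)

Section Vanishing.

Variable f : {bilinear V -> V -> V}.
Hypotheses (fC : commutative f) (fD : inf_equivariant f).
Variable e : 'I_7 -> W.
Hypothesis fe : g2_frame e.
Hypotheses (k3 : 3%:R != 0 :> k) (k5 : 5%:R != 0 :> k).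

Local Notation n i := (form (e i) (e i)).
Local Notation A i := (traceless (e i) (e i)).
Local Notation B i j := (traceless (e i) (e j)).

Let en := frame_norm fe.
Let eo := frame_orth fe.

Lemma der_image_diag D i j t : pure_derivation D -> D (e i) = t *: e j ->
  der_image D (A i) ((2%:R * t) *: B i j).
Proof.
move=> Dd Di; have := der_image_traceless Dd (e i) (e i).
rewrite Di linearZl_LR linearZr_LR /= (tracelessC (e j)) -mulr2n -scaler_nat.
by rewrite scalerA.
Qed.

Lemma der_image_offdiag D i j a b : pure_derivation D -> D (e i) = a *: e j ->
  D (e j) = b *: e i -> der_image D (B i j) (a *: A j + b *: A i).
Proof.
move=> Dd Di Dj; have := der_image_traceless Dd (e i) (e j).
by rewrite Di Dj linearZl_LR linearZr_LR.
Qed.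

Lemma der_image_kill D i : pure_derivation D -> D (e i) = 0 -> der_image D (A i) 0.
Proof.
move=> Dd Di; have := der_image_traceless Dd (e i) (e i).
by rewrite Di linear0l linear0r addr0.
Qed.

Lemma der_zero D x x' y y' : pure_derivation D -> der_image D x x' ->
  der_image D y y' -> f x y = 0 -> f x' y + f x y' = 0.
Proof.
move=> Dd xx' yy' xy0; apply: (der_image0 Dd).
by rewrite -xy0; apply: fD.
Qed.

(** The sum of the squares of the frame vectors divided by their norms is the identity, whose
    traceless part is zero. *)
Lemma diag_sum : \sum_i (n i)^-1 *: A i = 0.
Proof.
apply: operator_inj => w.
have -> : operator (\sum_i (n i)^-1 *: A i) w = \sum_i (n i)^-1 *: operator (A i) w.
  rewrite /operator !linear_sum /= sum_lfunE; apply: eq_bigr => i _.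
  exact: operatorZ.
have -> : operator (0 : V) w = 0 by rewrite -(scale0r (0 : V)) operatorZ scale0r.
transitivity (\sum_i ((form (e i) w / n i) *: e i - 7%:R^-1 *: w)).
  apply: eq_bigr => i _; rewrite operator_traceless symopE.
  apply: (form_inj k2) => v; rewrite !form_expand; have := en i => ni.
  by field; rewrite k2 ni k7.
rewrite sumrB -(orth_expansion k2 en eo erefl) sumr_const card_ord -scaler_nat.
by rewrite scalerA divff // scale1r subrr.
Qed.

(* Rotating $e_i$ towards $e_j$ with $e_l$ fixed moves the zero of
   $f(e_i^2, e_l^2)$ to $f(e_ie_j, e_l^2)$ and then to $f(e_j^2, e_l^2)$. *)
Lemma vanish_step i j l : i != j -> i != l -> j != l ->
  f (A i) (A l) = 0 -> f (B i j) (A l) = 0 /\ f (A j) (A l) = 0.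
Proof.
move=> ij il jl fil; have [D [s [Dd s0 Di Dj Dl]]] := frame_rotation k2 fe k3 ij il jl.
have Bij : f (B i j) (A l) = 0.
  have := der_zero Dd (der_image_diag Dd Di) (der_image_kill Dd Dl) fil.
  rewrite linear0r addr0 linearZl_LR /= => /eqP.
  by rewrite scaler_eq0 !mulf_eq0 (negPf k2) (negPf s0) (negPf (en i)) => /eqP.
split=> //; have := der_zero Dd (der_image_offdiag Dd Di Dj) (der_image_kill Dd Dl) Bij.
rewrite linear0r addr0 linearDl !linearZl_LR /= fil scaler0 addr0 => /eqP.
by rewrite scaler_eq0 !mulf_eq0 (negPf s0) (negPf (en i)) => /eqP.
Qed.

Lemma frame_span (M : lmodType k) (phi : V -> M) : linear phi ->
  (forall i j, phi (B i j) = 0) -> forall x, phi x = 0.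
Proof.
move=> phi_linear phi0.
pose h : {linear V -> M} := HB.pack phi (GRing.isLinear.Build k V M _ phi phi_linear).
apply: (traceless_span (phi := h)) => a b; rewrite -[_ = _]/(h (traceless a b) = 0).
rewrite (orth_expansion k2 en eo erefl a) linear_sumlz linear_sum big1 // => i _.
rewrite linearZl_LR linearZ /= (orth_expansion k2 en eo erefl b).
rewrite linear_sumr -[phi _]/(h _) linear_sum big1 ?scaler0 // => j _.
by rewrite linearZr_LR linearZ /= phi0 scaler0.
Qed.

Lemma exists_third (i j : 'I_7) : exists2 l, i != l & j != l.
Proof.
have /card_gt0P[l] : (0 < #|~: [set i; j]|)%N.
  by rewrite cardsCs setCK card_ord cards2; case: (i != j).
by rewrite !inE negb_or ![l == _]eq_sym => /andP[]; exists l.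
Qed.

Lemma vanishing : forall i j, i != j -> f (A i) (A j) = 0 -> forall x y, f x y = 0.
Proof.
move=> i0 j0 ij0 f00.
have st i j l : i != l -> j != l -> f (A i) (A l) = 0 -> f (A j) (A l) = 0.
  have [-> //|ij il jl fil] := eqVneq i j.
  by have [] := vanish_step ij il jl fil.
have fAA i j : f (A i) (A j) = 0.
  suff fAA1 : forall i j, i != j -> f (A i) (A j) = 0.
    have [->|/fAA1 //] := eqVneq i j.
    (* The rotations of [vanish_step] keep the two indices distinct; the linear relation between the
       squares reaches equal ones. *)
    have : f (A j) (\sum_l (n l)^-1 *: A l) = 0 by rewrite diag_sum linear0r.
    rewrite linear_sumr (bigD1 j) //= linearZr_LR /= big1 => [|l lj].
      by rewrite addr0 => /eqP; rewrite scaler_eq0 invr_eq0 (negPf (en j)) => /eqP.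
    by rewrite linearZr_LR /= fAA1 ?scaler0 // eq_sym.
  (* One index changes at a time, from (i0, j0) to (i, j0) to (i, j), so that the two indices stay
     distinct; [i = j0] needs a shorter route through commutativity. *)
  move=> {}i {}j ij; rewrite fC; case: (eqVneq j0 i) ij => [<-|j0i] ij.
    by apply: (st i0) f00 => //; rewrite eq_sym.
  apply: (st j0) => //; first by rewrite eq_sym.
  by rewrite fC; apply: (st i0) f00 => //; rewrite eq_sym.
have fBA i j l : i != j -> f (B i j) (A l) = 0.
  move=> ij; have fBAl p q : p != q -> f (B p q) (A p) = 0.
    move=> pq; have [r pr qr] := exists_third p q.
    have [D [s [Dd s0 Dp Dq Dr]]] := frame_rotation k2 fe k3 pq pr qr.
    have := der_zero Dd (der_image_diag Dd Dp) (der_image_diag Dd Dp) (fAA p p).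
    rewrite [f (A p) _]fC linearZl_LR /= -mulr2n -scaler_nat scalerA => /eqP.
    by rewrite scaler_eq0 !mulf_eq0 (negPf k2) (negPf s0) (negPf (en p)) => /eqP.
  have [<-|il] := eqVneq i l; first exact: fBAl.
  have [<-|jl] := eqVneq j l; first by rewrite tracelessC fBAl // eq_sym.
  by have [] := vanish_step ij il jl (fAA i l).
have fB1 j x : f x (A j) = 0.
  apply: (frame_span (phi := f^~ (A j))) => [t u v|p q]; first exact: linearPl.
  have [->|pq] := eqVneq p q; [exact: fAA | exact: fBA].
have fB2 i j x : i != j -> f x (B i j) = 0.
  move=> ij; have [l il jl] := exists_third i j.
  have [D [s [Dd s0 Di Dj Dl]]] := frame_rotation k2 fe k3 ij il jl.
  apply: (frame_span (phi := f^~ (B i j))) => [t u v|p q]; first exact: linearPl.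
  (* The term in which D acts on [B p q] is a value f(_, A i), already known to vanish; what remains
     is a nonzero multiple of the value sought. *)
  have := der_zero Dd (der_image_traceless Dd _ _) (der_image_diag Dd Di) (fB1 i (B p q)).
  rewrite fB1 add0r linearZr_LR /= => /eqP.
  by rewrite scaler_eq0 !mulf_eq0 (negPf k2) (negPf s0) (negPf (en i)) => /eqP.
move=> x; apply: (frame_span (phi := f x)) => [t u v|p q]; first exact: linearPr.
by have [->|pq] := eqVneq p q; [exact: fB1 | exact: fB2].
Qed.

Let i0 : 'I_7 := inord 0.
Let i1 : 'I_7 := inord 1.
Let i2 : 'I_7 := inord 2.
Let i3 : 'I_7 := inord 3.
Local Notation Q := (f (A i0) (A i1)).
Local Notation ev := matrix_coef.

Let i01 : i0 != i1. Proof. by rewrite -(inj_eq val_inj) /= !inordK. Qed.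
Let i02 : i0 != i2. Proof. by rewrite -(inj_eq val_inj) /= !inordK. Qed.
Let i12 : i1 != i2. Proof. by rewrite -(inj_eq val_inj) /= !inordK. Qed.

(** The derivation of [frame_rotation3] kills both arguments of Q, hence Q, so Q commutes with it.
    The three claims read this off at the pairs (e i, e i), (e i, e j) and (e l, e i). *)
Lemma fixed_coef (i j : 'I_7) : i != j -> (3 <= i)%N -> (3 <= j)%N ->
  [/\ ev Q (e i) (e j) = 0, ev Q (e i) (e i) * n j = ev Q (e j) (e j) * n i
    & forall l : 'I_7, (l < 3)%N -> ev Q (e l) (e j) = 0].
Proof.
move=> ij ige jge; have [D [s [Dd s0 Di Dj Dl]]] := frame_rotation3 k2 fe k3 ij ige jge.
have DA (l : 'I_7) : (l < 3)%N -> der_image D (A l) 0.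
  by move=> l3; apply: der_image_kill => //; apply: Dl.
have DQ : der_image D Q 0.
  have := fD Dd (DA i0 _) (DA i1 _); rewrite linear0l linear0r addr0; apply;
  by rewrite inordK.
have QD u w : ev Q (D u) w = - ev Q u (D w).
  have := der_image_coef Dd u w DQ; rewrite -(scale0r Q) matrix_coefZ mul0r => /esym/eqP.
  by rewrite subr_eq0 eq_sym => /eqP ->; rewrite opprK.
split.
- have := QD (e i) (e i); rewrite Di !matrix_coef_expand (matrix_coefC _ (e j)) => /eqP.
  rewrite -subr_eq0 opprK -mulr2n -mulr_natl !mulf_eq0 (negPf k2) (negPf s0).
  by rewrite (negPf (en i)) => /eqP.
- have := QD (e i) (e j); rewrite Di Dj !matrix_coef_expand => E; apply: (mulfI s0).
  by apply: (eq_of_subr (esym E)); ring.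
- move=> l l3; have := QD (e l) (e i); rewrite Di Dl // !matrix_coef_expand => /esym/eqP.
  by rewrite oppr_eq0 !mulf_eq0 (negPf s0) (negPf (en i)) => /eqP.
Qed.

(* With $D e_0 = \alpha e_1$ and $D e_1 = \beta e_0$, the tensor
   $e_0^2\otimes e_1^2$ is annihilated by $D^3 - 16\alpha\beta D$, whereas
   $D^2$ is $\alpha\beta$ or $4\alpha\beta$ on the coefficients at hand. *)
Lemma rotated_coef : [/\ ev Q (e i0) (e i1) = 0, ev Q (e i0) (e i2) = 0,
  ev Q (e i1) (e i2) = 0 & ev Q (e i0) (e i0) * n i1 = ev Q (e i1) (e i1) * n i0].
Proof.
have [D [s [Dd s0]]] := frame_rotation k2 fe k3 i01 i02 i12.
set a := s * n i0; set b := - (s * n i1) => D0 D1 D2.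
have q0 : a * b != 0 by rewrite /a /b mulrN oppr_eq0 !mulf_neq0.
(* Together with Q these values span a space that D maps to itself, which allows its powers on Q to
   be computed. *)
pose P := f (A i0) (A i0); pose R := f (A i1) (A i1); pose M := f (A i0) (B i0 i1).
pose N := f (A i1) (B i0 i1); pose L := f (B i0 i1) (B i0 i1).
have DA0 := der_image_diag Dd D0.
have DA1 : der_image D (A i1) ((2%:R * b) *: B i0 i1).
  by rewrite tracelessC; apply: der_image_diag.
have DB := der_image_offdiag Dd D0 D1.
have DQ : der_image D Q ((2%:R * a) *: N + (2%:R * b) *: M).
  by have := fD Dd DA0 DA1; rewrite linearZl_LR linearZr_LR /= (fC (B i0 i1)).
have DP : der_image D P ((4%:R * a) *: M).
  have := fD Dd DA0 DA0; rewrite linearZl_LR linearZr_LR /= (fC (B i0 i1)).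
  by rewrite -scalerDl -mulrDl -natrD.
have DR : der_image D R ((4%:R * b) *: N).
  have := fD Dd DA1 DA1; rewrite linearZl_LR linearZr_LR /= (fC (B i0 i1)).
  by rewrite -scalerDl -mulrDl -natrD.
have DM : der_image D M ((2%:R * a) *: L + (a *: Q + b *: P)).
  by have := fD Dd DA0 DB; rewrite linearZl_LR linearDr !linearZr_LR.
have DN : der_image D N ((2%:R * b) *: L + (a *: R + b *: Q)).
  have := fD Dd DA1 DB; rewrite linearZl_LR linearDr !linearZr_LR /=.
  by rewrite (fC (A i1) (A i0)).
have DL : der_image D L ((2%:R * a) *: N + (2%:R * b) *: M).
  have := fD Dd DB DB; rewrite linearDr linearDl !linearZr_LR !linearZl_LR /=.
  by rewrite (fC (B i0 i1) (A i0)) (fC (B i0 i1) (A i1)) -/M -/N -mulr2n -scaler_nat scalerDr !scalerA.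
set dQ := _ + _ in DQ DL.
pose Z := der_imageZ Dd; pose S := der_imageD Dd.
have DdQ := S _ _ _ _ (Z (2%:R * a) _ _ DN) (Z (2%:R * b) _ _ DM).
rewrite -/dQ in DdQ; set d2Q := _ + _ in DdQ.
have Dd2Q := S _ _ _ _
  (Z (2%:R * a) _ _ (S _ _ _ _ (Z (2%:R * b) _ _ DL)
                       (S _ _ _ _ (Z a _ _ DR) (Z b _ _ DQ))))
  (Z (2%:R * b) _ _ (S _ _ _ _ (Z (2%:R * a) _ _ DL)
                       (S _ _ _ _ (Z a _ _ DQ) (Z b _ _ DP)))).
rewrite -/d2Q in Dd2Q; set d3Q := _ + _ in Dd2Q.
(* Origin of 16: divided by their norms, the two squares are u + v and u - v, where D kills u and
   its square multiplies v by 4ab. Commutativity of [f] cancels the cross terms, so Q is a multiple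
   of f(u,u) - f(v,v). Here D kills f(u,u), while f(v,v) has only the weights 0 and twice those of
   v, whence the factor 4 * 4ab. *)
have d3QE u w : ev d3Q u w = 16%:R * (a * b) * ev dQ u w.
  by rewrite !matrix_coef_expand; ring.
have c1 u w := der_image_coef Dd u w DQ; have c2 u w := der_image_coef Dd u w DdQ.
have c3 u w := der_image_coef Dd u w Dd2Q.
clearbody dQ d2Q d3Q; move: d3QE c1 c2 c3 => d3QE c1 c2 c3.
have ab0 : a != 0 /\ b != 0 by move: q0; rewrite mulf_eq0 negb_or => /andP.
(* For a literal [m] the factor [m != 0] computes to 1, which explains the shapes [15 * 1] and
   [12 * 1]. These are 16 - 1 and 16 - 4, for coefficients on which the square of D is ab or 4ab. *)
have cancel (m : nat) z : (m * (m != 0))%:R != 0 :> k -> m%:R * (a * b) * z = 0 -> z = 0.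
  case: m => [|m]; rewrite ?mul0n ?eqxx // muln1 => m0 /eqP.
  by rewrite mulf_eq0 mulf_eq0 (negPf m0) (negPf q0) => /eqP.
have k15 : (15 * 1)%:R != 0 :> k by rewrite (natrM _ 3 5) mulf_neq0.
have k12 : (12 * 1)%:R != 0 :> k by rewrite (natrM _ 3 4) (natrM _ 2 2) !mulf_neq0.
have E x x' i j : (forall u w, ev x' u w = - ev x (D u) w - ev x u (D w)) ->
  ev x' (e i) (e j) = - ev x (D (e i)) (e j) - ev x (e i) (D (e j)) by [].
have at01 x x' (H : forall u w, ev x' u w = - ev x (D u) w - ev x u (D w)) :
  (ev x' (e i0) (e i0) = - (2%:R * a * ev x (e i0) (e i1)))
  * (ev x' (e i1) (e i1) = - (2%:R * b * ev x (e i0) (e i1)))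
  * (ev x' (e i0) (e i1) = - (a * ev x (e i1) (e i1)) - b * ev x (e i0) (e i0))
  * (ev x' (e i0) (e i2) = - (a * ev x (e i1) (e i2)))
  * (ev x' (e i1) (e i2) = - (b * ev x (e i0) (e i2))).
  rewrite !H D0 D1 D2 !matrix_coef_expand !(matrix_coefC x (e i1) (e i0)).
  by do !split; ring.
have {}c1 := at01 _ _ c1; have {}c2 := at01 _ _ c2; have {at01}c3 := at01 _ _ c3.
rewrite !d3QE !c2 in c3.
have x12 : ev dQ (e i1) (e i2) = 0.
  by apply: (cancel _ _ k15); apply: (eq_of_subr c3.2); ring.
have x02 : ev dQ (e i0) (e i2) = 0.
  by apply: (cancel _ _ k15); apply: (eq_of_subr c3.1.2); ring.
have x01 : ev dQ (e i0) (e i1) = 0.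
  by apply: (cancel _ _ k12); apply: (eq_of_subr c3.1.1.2); ring.
have x_diag : a * ev dQ (e i1) (e i1) + b * ev dQ (e i0) (e i0) = 0.
  apply: (cancel _ _ k12).
  have := congr2 (fun s t => a * s + b * t) c3.1.1.1.2 c3.1.1.1.1 => /= H.
  by apply: (eq_of_subr H); ring.
rewrite !c1 in x12 x02 x01 x_diag.
have [a0 b0] := ab0; split.
- apply: (@cancel 4%N); first by rewrite muln1 (natrM _ 2 2) mulf_neq0.
  by apply: (eq_of_subr (esym x_diag)); ring.
- by apply: (mulfI b0); apply: (eq_of_subr (esym x12)); ring.
- by apply: (mulfI a0); apply: (eq_of_subr (esym x02)); ring.
- by apply: (mulfI s0); apply: (eq_of_subr x01); rewrite /a /b; ring.
Qed.

(** The two hypotheses are what [fixed_coef] and [rotated_coef] leave open. Under them Q is a scalar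
    operator c; its trace 7c is zero, so Q = 0 and [vanishing] applies. *)
Lemma vanishing_criterion :
    ev Q (e i0) (e i0) * n i2 = ev Q (e i2) (e i2) * n i0 ->
    ev Q (e i0) (e i0) * n i3 = ev Q (e i3) (e i3) * n i0 ->
  forall x y, f x y = 0.
Proof.
move=> Q2 Q3; apply: (vanishing i01).
have [Q01 Q02 Q12 Q1] := rotated_coef.
pose c : k := ev Q (e i0) (e i0) / n i0.
have i3_ge : (3 <= i3)%N by rewrite inordK.
have diag i : ev Q (e i) (e i) = c * n i.
  have H j : ev Q (e i0) (e i0) * n j = ev Q (e j) (e j) * n i0 ->
      ev Q (e j) (e j) = c * n j.
    by move=> E; apply: (mulIf (en i0)); rewrite -E /c mulrAC divfK.
  have [i3_le|/ord7_lt3[->|[->|->]]] := leqP 3 i; try exact: H.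
  have [->|ii3] := eqVneq i i3; first exact: H.
  apply: (mulIf (en i3)); have [_ -> _] := fixed_coef ii3 i3_le i3_ge.
  by rewrite (H i3) // mulrAC.
have off i j : i != j -> ev Q (e i) (e j) = 0.
  (* [fixed_coef] requires a second index that is at least 3; 4 serves as partner when [q] is
     [i3]. *)
  have i4_3 : inord 4 != i3 by rewrite -(inj_eq val_inj) /= !inordK.
  have low (p q : 'I_7) : (3 <= q)%N -> (p < 3)%N -> ev Q (e p) (e q) = 0.
    move=> q3; have [->|qi3] := eqVneq q i3.
      by have [||_ _] := fixed_coef i4_3; [rewrite inordK| |apply].
    by rewrite eq_sym in qi3; have [_ _] := fixed_coef qi3 i3_ge q3; apply.
  move=> ij; have [i3_le|i_lt] := leqP 3 i; have [j3_le|j_lt] := leqP 3 j.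
  - by have [] := fixed_coef ij i3_le j3_le.
  - by rewrite matrix_coefC low.
  - exact: low.
  - case: (ord7_lt3 i_lt) ij => [->|[->|->]]; case: (ord7_lt3 j_lt) => [->|[->|->]];
    by rewrite ?eqxx // matrix_coefC.
have opE i : operator Q (e i) = c *: e i.
  apply: (form_inj k2) => z; rewrite (orth_expansion k2 en eo erefl z).
  rewrite !linear_sumr; apply: eq_bigr => j _; rewrite !linearZr_LR /=; congr (_ * _).
  rewrite -[LHS]/(ev Q (e i) (e j)) form_expand.
  by have [->|ij] := eqVneq i j; [rewrite diag | rewrite off // eo // mulr0].
have opcE u : operator Q u = c *: u.
  rewrite (orth_expansion k2 en eo erefl u) /operator linear_sum scaler_sumr.
  apply: eq_bigr => i _; rewrite linearZ /= -/(operator _ _) opE.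
  by rewrite !scalerA mulrC.
have c0 : c = 0.
  have := subvsP Q; rewrite memv_ker lfunE /= /contract (eq_bigr (fun=> c)).
    rewrite sumr_const card_ord dim_pure // => /eqP c7.
    by apply: (mulfI k7); rewrite mulr0 mulr_natl.
  move=> i _; rewrite -[form _ _]/(form (operator Q (pdual i)) (pbase i)) opcE form_expand form_pdual //.
  by rewrite eqxx mulr1.
by apply: operator_inj => w; rewrite opcE c0 -(scale0r (0 : V)) operatorZ !scale0r.
Qed.

End Vanishing.
End TracelessOperators.

(** * Scalar extension and dual numbers *)

Lemma scale_swap (R : comNzRingType) (M : lmodType R) (a b : R) (x : M) :
  a *: (b *: x) = b *: (a *: x).
Proof. by rewrite !scalerA mulrC. Qed.

Section ScalarExtension.

Variables (k : fieldType) (R : comAlgType k).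
Implicit Types U V T : vectType k.

Fact ext_lin_linear U V (f : U -> V) : linear (@ext_lin k R U V f).
Proof.
move=> a u v; rewrite /ext_lin scaler_sumr -big_split /=.
by apply: eq_bigr => i _; rewrite !mxE scalerDl scalerA.
Qed.

HB.instance Definition _ U V (f : U -> V) := GRing.isLinear.Build R
  (scalar_ext R U) (scalar_ext R V) _ (@ext_lin k R U V f) (ext_lin_linear f).

Fact ext_bil_linearl U V T (f : U -> V -> T) v : linear ((@ext_bil k R U V T f)^~ v).
Proof.
move=> a u u'; rewrite /ext_bil scaler_sumr -big_split /=.
apply: eq_bigr => i _; rewrite scaler_sumr -big_split /=.
by apply: eq_bigr => j _; rewrite !mxE mulrDl scalerDl scalerA mulrA.
Qed.

Fact ext_bil_linearr U V T (f : U -> V -> T) u : linear (@ext_bil k R U V T f u).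
Proof.
move=> a v v'; rewrite /ext_bil scaler_sumr -big_split /=.
apply: eq_bigr => i _; rewrite scaler_sumr -big_split /=.
by apply: eq_bigr => j _; rewrite !mxE mulrDr scalerDl scalerA mulrCA.
Qed.

HB.instance Definition _ U V T (f : U -> V -> T) := bilinear_isBilinear.Build R
  (scalar_ext R U) (scalar_ext R V) (scalar_ext R T) _ _ (@ext_bil k R U V T f)
  (ext_bil_linearl f, ext_bil_linearr f).

Lemma ext_vec_expansion V (u : scalar_ext R V) :
  u = \sum_i u 0 i *: ext_vec R (vbasis {: V})`_i.
Proof.
apply/rowP => j; rewrite summxE (bigD1 j) //= !mxE coord_free ?(basis_free (vbasisP _)) //.
rewrite eqxx scale1r mulr1 big1 ?addr0 // => i ij.
by rewrite !mxE coord_free ?(basis_free (vbasisP _)) // (negPf ij) scale0r mulr0.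
Qed.

(** Applied to one argument after another, this reduces a multilinear identity over [R] to the same
    identity over [k]. *)
Lemma ext_vec_ind V (M : lmodType R) (phi psi : scalar_ext R V -> M) :
    linear phi -> linear psi -> (forall v, phi (ext_vec R v) = psi (ext_vec R v)) ->
  forall u, phi u = psi u.
Proof.
move=> phiL psiL eq_vec u.
pose h1 : {linear scalar_ext R V -> M} := HB.pack phi (GRing.isLinear.Build R _ M _ phi phiL).
pose h2 : {linear scalar_ext R V -> M} := HB.pack psi (GRing.isLinear.Build R _ M _ psi psiL).
rewrite -[phi u]/(h1 u) -[psi u]/(h2 u) (ext_vec_expansion u) !linear_sum.
by apply: eq_bigr => i _; rewrite !linearZ /= eq_vec.
Qed.

Lemma ext_lin_vecE U V (f : U -> V) : linear f ->
  forall u, ext_lin f (ext_vec R u) = ext_vec R (f u).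
Proof.
move=> fL u; pose h : {linear U -> V} := HB.pack f (GRing.isLinear.Build k _ _ _ f fL).
exact: (ext_lin_vec R h).
Qed.

Fact ext_vec_linear V a (u v : V) :
  ext_vec R (a *: u + v) = a%:A *: ext_vec R u + ext_vec R v.
Proof.
apply/rowP => i; rewrite !mxE linearP /= scalerDl.
by rewrite -!/(in_alg R _) rmorphM.
Qed.

Lemma ext_vecD V (u v : V) : ext_vec R (u + v) = ext_vec R u + ext_vec R v.
Proof. by rewrite -[u in LHS]scale1r ext_vec_linear !scale1r. Qed.

Lemma ext_vec0 V : ext_vec R (0 : V) = 0.
Proof. by apply/rowP => i; rewrite !mxE linear0 scale0r. Qed.

Lemma ext_vecZ V a (v : V) : ext_vec R (a *: v) = a%:A *: ext_vec R v.
Proof. by rewrite -[a *: v]addr0 ext_vec_linear ext_vec0 addr0. Qed.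

Lemma ext_vecB V (u v : V) : ext_vec R (u - v) = ext_vec R u - ext_vec R v.
Proof. by rewrite ext_vecD -scaleN1r ext_vecZ !scaleN1r. Qed.

(** The element [a] may be nilpotent: the coordinates of [u] and [v] lie in [k], and multiplying a
    nonzero element of the k-vector space [R] by a nonzero scalar does not give zero. *)
Lemma ext_vec_inj V (a : R) (u v : V) : a != 0 ->
  a *: ext_vec R u = a *: ext_vec R v -> u = v.
Proof.
move=> a0 /rowP uv; rewrite (coord_vbasis (memvf u)) (coord_vbasis (memvf v)).
apply: eq_bigr => i _; congr (_ *: _); have := uv i; rewrite !mxE -!scalerAr !mulr1.
by move=> /eqP; rewrite -subr_eq0 -scalerBl scaler_eq0 (negPf a0) orbF subr_eq0 => /eqP.
Qed.

End ScalarExtension.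

Lemma exists_dual_number (k : fieldType) :
  exists (R : comAlgType k) (eps : R), eps != 0 /\ eps * eps = 0.
Proof.
exists {poly %/ ('X^2 : {poly k})}, 'qX; split.
  have X3 : (size ('X^2 : {poly k}) = 3)%N by rewrite size_polyXn.
  apply/eqP => /(congr1 (@polyn _ _)); rewrite qpolyXE ?X3 ?monicXn // => /eqP.
  by rewrite polyX_eq0.
rewrite -in_qpolyM -expr2; apply: val_inj => /=.
by rewrite mk_monic_Xn Pdiv.RingMonic.rmodpp ?monicXn.
Qed.

(** * Automorphisms over the dual numbers *)

Section InfinitesimalAutomorphism.

Variables (k : fieldType) (O : octonion_algebra k).
Hypothesis k2 : 2%:R != 0 :> k.
Local Notation W := (pure O).
Local Notation V := (V27T O).
Local Notation one := (oone O).
Local Notation "a ## b" := (malcev a b) (at level 40, left associativity).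

Fact operator_linearl w : linear ((@operator k O)^~ w).
Proof. by move=> t x y; rewrite operatorD operatorZ. Qed.

Fact operator_linearr x : linear (@operator k O x).
Proof. by move=> t u v; rewrite /operator linearP. Qed.

HB.instance Definition _ := bilinear_isBilinear.Build k V W W _ _ (@operator k O)
  (operator_linearl, operator_linearr).

Definition pure_part (x : O) : W :=
  vsproj (pureV O) (x - (2%:R^-1 * pairing x one) *: one).

Fact pure_part_linear : linear pure_part.
Proof.
move=> t x y; rewrite /pure_part -linearP; congr vsproj.
apply: pairing_inj => z; rewrite !pairing_expand; ring.
Qed.

Lemma octonion_decomposition x :
  x = (2%:R^-1 * pairing x one) *: one + vsval (pure_part x).
Proof.
rewrite /pure_part vsprojK; first by rewrite [RHS]addrC subrK.
rewrite mem_pureV; apply/eqP; set c := _ * _.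
by rewrite !pairing_expand pairing11 /c mulrAC mulVf // mul1r subrr.
Qed.

Lemma pure_part_val (w : W) : pure_part (vsval w) = w.
Proof. by rewrite /pure_part pure_pairing1 mulr0 scale0r subr0 vsvalK. Qed.

Lemma pure_part_one : pure_part one = 0.
Proof. by rewrite /pure_part pairing11 mulVf // scale1r subrr linear0. Qed.

Variable D : W -> W.
Hypothesis Dd : pure_derivation D.

Definition der_ext (x : O) : O := vsval (D (pure_part x)).

Fact der_ext_linear : linear der_ext.
Proof. by move=> t x y; rewrite /der_ext pure_part_linear (der_linear Dd) linearP. Qed.

Lemma der_ext_val w : der_ext (vsval w) = vsval (D w).
Proof. by rewrite /der_ext pure_part_val. Qed.

(** The product of pure octonions is half of their Malcev product minus their form times the
    identity. The Leibniz rule on W handles the pure part, and skewness of [D] handles the multiple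
    of the identity, which [der_ext] kills. *)
Lemma der_ext_mul x y : der_ext (omul O x y) = omul O (der_ext x) y + omul O x (der_ext y).
Proof.
have E s (u : W) : der_ext (s *: one + vsval u) = vsval (D u).
  have d1 : der_ext one = 0 by rewrite /der_ext pure_part_one (der0 Dd) linear0.
  by rewrite der_ext_linear d1 scaler0 add0r der_ext_val.
rewrite (octonion_decomposition x) (octonion_decomposition y).
move: (pure_part x) (pure_part y) (_ * pairing x _) (_ * pairing y _) => u v s t.
rewrite !E !linearDl !linearDr /= !linearZl_LR !linearZr_LR /= !omul1l !omul1r !omul_pure //.
have -> : s *: (t *: one) + s *: vsval v + (t *: vsval u + 2%:R^-1 *: (vsval (u ## v) - form u v *: one))
   = (s * t - 2%:R^-1 * form u v) *: one + vsval (s *: v + t *: u + 2%:R^-1 *: (u ## v)).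
  rewrite !linearD !linearZ /=; apply: pairing_inj => z; rewrite !pairing_expand; ring.
rewrite E !(derD _ _ Dd) !(derZ _ _ Dd) (der_malcev Dd) (der_skew Dd) !linearD !linearZ /=.
apply: pairing_inj => z; rewrite !pairing_expand; ring.
Qed.


Variables (R : comAlgType k) (eps : R).
Hypotheses (eps0 : eps != 0) (eps2 : eps * eps = 0).

Definition inf_aut (x : scalar_ext R O) : scalar_ext R O :=
  x + eps *: ext_lin der_ext x.

Fact inf_aut_linear : linear inf_aut.
Proof.
by move=> t x y; rewrite /inf_aut linearP !scalerDr scale_swap addrACA.
Qed.

HB.instance Definition _ := GRing.isLinear.Build R
  (scalar_ext R O) (scalar_ext R O) _ inf_aut inf_aut_linear.

Lemma eps_scale2 (M : lmodType R) (x : M) : eps *: (eps *: x) = 0.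
Proof. by rewrite scalerA eps2 scale0r. Qed.

Lemma ext_der_ext_mul x y : ext_lin der_ext (ext_bil (omul O) x y)
  = ext_bil (omul O) (ext_lin der_ext x) y + ext_bil (omul O) x (ext_lin der_ext y) :> scalar_ext R O.
Proof.
move: x; apply: ext_vec_ind => [t u v|t u v|x].
- by rewrite !linearPl linearP.
- by rewrite linearP !linearPl scalerDr addrACA.
move: y; apply: ext_vec_ind => [t u v|t u v|y].
- by rewrite !linearPr linearP.
- by rewrite linearP !linearPr scalerDr addrACA.
rewrite ext_bil_vec !(ext_lin_vecE _ der_ext_linear) !ext_bil_vec der_ext_mul.
exact: ext_vecD.
Qed.

Lemma inf_aut_is_aut : is_aut inf_aut.
Proof.
split; last first.
  move=> x y; rewrite /= /inf_aut linearDl !linearDr /= !linearZl_LR !linearZr_LR /=.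
  by rewrite eps_scale2 addr0 ext_der_ext_mul scalerDr [in RHS]addrAC addrA.
have DZ z : ext_lin der_ext (eps *: z) = eps *: ext_lin der_ext z :> scalar_ext R O.
  exact: linearZ.
exists (fun x => x - eps *: ext_lin der_ext x) => x; rewrite /= /inf_aut.
  by rewrite [ext_lin _ (_ + _)]linearD /= DZ scalerDr eps_scale2 addr0 addrK.
by rewrite [ext_lin _ (_ - _)]linearB /= DZ scalerBr eps_scale2 subr0 subrK.
Qed.

Lemma aut_pure_linear (g : {linear scalar_ext R O -> scalar_ext R O}) :
  linear (aut_pure g).
Proof. by move=> t u v; rewrite /aut_pure !linearP. Qed.

Lemma aut_pure_inf w :
  aut_pure inf_aut w = w + eps *: ext_lin D w.
Proof.
move: w; apply: ext_vec_ind => [t u v|t u v|w]; first exact: aut_pure_linear.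
- by rewrite linearP !scalerDr scale_swap addrACA.
rewrite (ext_lin_vecE _ (der_linear Dd)) /aut_pure ext_lin_vec /inf_aut.
rewrite (ext_lin_vecE _ der_ext_linear) linearD linearZ /= !ext_lin_vec /=.
by rewrite der_ext_val !vsvalK.
Qed.

Lemma inf_aut_image x x' : der_image D x x' ->
  aut_image inf_aut (ext_vec R x) (ext_vec R x + eps *: ext_vec R x').
Proof.
move=> xx'; apply: ext_vec_ind => [t u v|t u v|w].
- by rewrite aut_pure_linear linearPr.
- by rewrite linearPr aut_pure_linear.
rewrite !aut_pure_inf ext_bil_vec !(ext_lin_vecE _ (der_linear Dd)).
rewrite linearDl !linearDr /= !linearZl_LR !linearZr_LR /= eps_scale2 addr0.
rewrite !ext_bil_vec -addrA -scalerDr -ext_vecD; congr (_ + _ *: ext_vec _ _).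
by rewrite /= xx' addrC subrK.
Qed.

(** The Leibniz rule is the coefficient of [eps] in the equivariance under the automorphism id + eps
    D. *)
Lemma equivariant_der_image (f : {bilinear V -> V -> V}) : equivariant f ->
  forall x x' y y', der_image D x x' -> der_image D y y' ->
  der_image D (f x y) (f x' y + f x y').
Proof.
move=> fG x x' y y' /inf_aut_image xx' /inf_aut_image yy' w.
have /(_ (ext_vec R w)) := fG R inf_aut inf_aut_is_aut _ _ _ _ xx' yy'.
rewrite !aut_pure_inf !ext_bil_vec !(ext_lin_vecE _ (der_linear Dd)).
rewrite [ext_bil f (_ + _) _]linearDl !linearDr /= !linearZl_LR !linearZr_LR /=.
rewrite eps_scale2 addr0 !ext_bil_vec.
rewrite !linearDl /= !linearZl_LR /= !scalerDr !eps_scale2 !addr0 !ext_bil_vec.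
rewrite -!addrA => /addrI; rewrite -!scalerDr -!ext_vecD => /(ext_vec_inj eps0) /= <-.
by rewrite addrA addrK addrC.
Qed.

End InfinitesimalAutomorphism.

(** * Trace formulas for the two products *)

Section TwoProducts.

Variables (k : fieldType) (O : octonion_algebra k).
Hypotheses (k2 : 2%:R != 0 :> k) (k7 : 7%:R != 0 :> k).
Local Notation W := (pure O).
Local Notation V := (V27T O).
Local Notation S := (S2 O).
Local Notation "a ## b" := (malcev a b) (at level 40, left associativity).

Lemma S2extend2C phi : (forall a b c d : W, phi a b c d = phi c d a b) ->
  commutative (S2extend2 phi).
Proof.
move=> phiC A B; rewrite /S2extend2 exchange_big.
by apply: eq_bigr => i _; apply: eq_bigr => j _; rewrite phiC.
Qed.

Lemma odot1C : commutative (@odot1 k O).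
Proof.
apply: S2extend2C => a b c d; rewrite /odot1_on.
rewrite (malcevC c a) (malcevC d b) (malcevC c b) (malcevC d a).
rewrite !linearNl !linearNr /= !opprK (symC (b ## c)) !(formC c) !(formC d).
by rewrite [form b c * _]mulrC.
Qed.

Lemma odot2C : commutative (@odot2 k O).
Proof.
apply: S2extend2C => a b c d; rewrite /odot2_on.
rewrite !(formC c) !(formC d) (symC d b) (symC d a) (symC c b) (symC c a).
by rewrite (mulrC (form b c)) [form a c *: _ + _ + _]addrAC.
Qed.

Lemma form_malcev_sum (a b c d : W) :
  form (a ## c) (b ## d) + form (a ## d) (b ## c) =
    4%:R * form a b * form c d - 2%:R * (form a c * form b d + form a d * form b c).
Proof.
rewrite !form_malcev (malcevC b d) (malcevC b c) !malcev_expand (malcev_swap k2 c d).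
by rewrite !form_expand (formC c b) (formC d b); ring.
Qed.

(** Origin of 2/7: the identity has trace 7, so the correction contributes 2 times its bracket and
    cancels the second term of [form_malcev_sum]. The remaining term is a product of traces, zero on
    [V27]. *)
Lemma contract_odot1 (A B : S) :
  contract (odot1 A B) = 4%:R * (contract A * contract B).
Proof.
rewrite /odot1 /S2extend2 linear_sum /= {2 3}/contract mulr_suml mulr_sumr.
apply: eq_bigr => i _; rewrite linear_sum mulr_sumr mulr_sumr.
apply: eq_bigr => j _; rewrite /odot1_on !linearD linearZ /= !contractE // contract_S2id //.
rewrite form_malcev_sum [_ *: _]mulrC.
by field.
Qed.

Lemma contract_odot2 (A B : S) : contract (odot2 A B) = 0.
Proof.
rewrite /odot2 /S2extend2 linear_sum big1 // => i _; rewrite linear_sum big1 // => j _.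
rewrite /odot2_on linearB !linearD !linearZ /= !contractE // contract_S2id //.
by rewrite -![_ *: _]/(_ * _); field.
Qed.

Lemma odot1_V27 (A B : S) : A \in V27 O -> B \in V27 O -> odot1 A B \in V27 O.
Proof.
rewrite !memv_ker !lfunE /= => /eqP A0 _.
by rewrite contract_odot1 A0 mul0r mulr0.
Qed.

Lemma odot2_V27 (A B : S) : A \in V27 O -> B \in V27 O -> odot2 A B \in V27 O.
Proof. by move=> _ _; rewrite memv_ker lfunE /= contract_odot2. Qed.

Definition prod1 (x y : V) : V := vsproj (V27 O) (odot1 (vsval x) (vsval y)).
Definition prod2 (x y : V) : V := vsproj (V27 O) (odot2 (vsval x) (vsval y)).

Lemma val_prod1 x y : vsval (prod1 x y) = odot1 (vsval x) (vsval y).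
Proof. by apply: vsprojK; apply: odot1_V27; apply: subvsP. Qed.

Lemma val_prod2 x y : vsval (prod2 x y) = odot2 (vsval x) (vsval y).
Proof. by apply: vsprojK; apply: odot2_V27; apply: subvsP. Qed.

Lemma prod1C : commutative prod1.
Proof. by move=> x y; rewrite /prod1 odot1C. Qed.

Lemma prod2C : commutative prod2.
Proof. by move=> x y; rewrite /prod2 odot2C. Qed.

Fact prod1_linearl y : linear (prod1^~ y).
Proof. by move=> t u v; rewrite /prod1 linearP linearPl linearP. Qed.

Fact prod1_linearr x : linear (prod1 x).
Proof. by move=> t u v; rewrite /prod1 linearP linearPr linearP. Qed.

Fact prod2_linearl y : linear (prod2^~ y).
Proof. by move=> t u v; rewrite /prod2 linearP linearPl linearP. Qed.

Fact prod2_linearr x : linear (prod2 x).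
Proof. by move=> t u v; rewrite /prod2 linearP linearPr linearP. Qed.

HB.instance Definition _ := bilinear_isBilinear.Build k V V V _ _ prod1
  (prod1_linearl, prod1_linearr).

HB.instance Definition _ := bilinear_isBilinear.Build k V V V _ _ prod2
  (prod2_linearl, prod2_linearr).

Definition op_trace (X : W -> W) : k := \sum_i form (X (pdual i)) (pbase i).

Lemma form_dual_sum (p q : W) : \sum_i form (pdual i) p * form (pbase i) q = form p q.
Proof.
rewrite -[in RHS](sum_form_pdual k2 p) linear_sumlz; apply: eq_bigr => i _.
by rewrite linearZl_LR /= (formC p).
Qed.

Lemma S2_self (A : S) u w : form (vsval A u) w = form u (vsval A w).
Proof. exact: ((mem_S2V k2 _).1 (subvsP A)). Qed.

Lemma form_dual_sum_op (A : S) (p q : W) :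
  \sum_i form (vsval A (pdual i)) p * form (pbase i) q = form (vsval A p) q.
Proof.
by rewrite -form_dual_sum; apply: eq_bigr => i _; rewrite S2_self.
Qed.

Lemma form_symop (a b u w : W) : form (symop a b u) w =
  2%:R^-1 * (form b u * form a w + form a u * form b w).
Proof. by rewrite symopE !form_expand. Qed.

(** By associativity of the form, the Malcev products move onto [u] and [w]. The sum over one pair
    of dual bases then reassembles the operator [A], and the sum over the other is a trace. *)
Lemma odot1_op (A B : S) u w : form (vsval (odot1 A B) u) w =
  - op_trace (fun t => u ## vsval A (w ## vsval B t))
  - op_trace (fun t => w ## vsval A (u ## vsval B t))
  + 4%:R / 7%:R * op_trace (fun t => vsval A (vsval B t)) * form u w.
Proof.
have tr_shift (v v' : W) j : form (vsval A (vsval B (pdual j) ## v)) (pbase j ## v')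
    = - form (v' ## vsval A (v ## vsval B (pdual j))) (pbase j).
  rewrite (malcevC _ v) linearN /= !form_expand (malcevC _ v') form_expand opprK.
  by rewrite -form_malcev (malcevC _ v') form_expand.
have step i j : form (vsval (odot1_on (vsval A (pdual i)) (pbase i)
      (vsval B (pdual j)) (pbase j)) u) w =
    2%:R^-1 * (form (vsval A (pdual i)) (vsval B (pdual j) ## u) * form (pbase i) (pbase j ## w)
    + form (vsval A (pdual i)) (vsval B (pdual j) ## w) * form (pbase i) (pbase j ## u)
    + (form (vsval A (pdual i)) (pbase j ## u) * form (pbase i) (vsval B (pdual j) ## w)
    + form (vsval A (pdual i)) (pbase j ## w) * form (pbase i) (vsval B (pdual j) ## u)))
    + 2%:R / 7%:R * (form (vsval A (pdual i)) (vsval B (pdual j)) * form (pbase i) (pbase j)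
    + form (vsval A (pdual i)) (pbase j) * form (pbase i) (vsval B (pdual j))) * form u w.
  rewrite /odot1_on !linearD linearZ /= !val_sym val_S2id // !add_lfunE scale_lfunE id_lfunE.
  by rewrite !form_expand !form_symop !form_malcev; ring.
rewrite /odot1 /S2extend2 linear_sum sum_lfunE linear_sumlz.
under eq_bigr => i _ do rewrite linear_sum sum_lfunE linear_sumlz (eq_bigr _ (fun j _ => step i j)).
rewrite exchange_big /= /op_trace -!sumrN mulr_sumr mulr_suml -!big_split /=.
apply: eq_bigr => j _; rewrite big_split -mulr_sumr /= !big_split /= -mulr_suml -mulr_sumr.
rewrite big_split /= !form_dual_sum_op !tr_shift.
have flip p q : form (vsval A p) q = form (vsval A q) p by rewrite S2_self formC.
rewrite (flip (pbase j ## u)) (flip (pbase j ## w)) (flip (pbase j)) !tr_shift.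
by field; rewrite k2 k7.
Qed.

(** Hence the second product is, up to a factor, the Jordan product of symmetric operators with its
    trace removed. *)
Lemma odot2_op (A B : S) u : vsval (odot2 A B) u =
  2%:R *: (vsval A (vsval B u) + vsval B (vsval A u))
  - (4%:R / 7%:R * op_trace (fun t => vsval A (vsval B t))) *: u.
Proof.
apply: (form_inj k2) => w.
pose P i x y : k := form (vsval A (pdual i)) x * form (pbase i) y.
have step i j : form (vsval (odot2_on (vsval A (pdual i)) (pbase i)
      (vsval B (pdual j)) (pbase j)) u) w =
    let c := vsval B (pdual j) in let d := pbase j in
    2%:R^-1 * (P i c u * form d w + P i c w * form d u + P i d u * form c w
      + P i d w * form c u + P i u c * form d w + P i w c * form d u
      + P i u d * form c w + P i w d * form c u)
    + - (2%:R / 7%:R) * (P i c d + P i d c) * form u w.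
  rewrite /P /odot2_on -scaleNr !linearD !linearZ /= !val_sym val_S2id //.
  rewrite !add_lfunE !scale_lfunE id_lfunE !form_expand !form_symop.
  by rewrite !(formC u) !(formC w); ring.
have flip (C : S) x y : form (vsval C x) y = form (vsval C y) x by rewrite S2_self formC.
rewrite /odot2 /S2extend2 linear_sum sum_lfunE linear_sumlz.
under eq_bigr => i _ do rewrite linear_sum sum_lfunE linear_sumlz (eq_bigr _ (fun j _ => step i j)).
rewrite exchange_big /= !form_expand.
transitivity (\sum_j (
  form (vsval B (pdual j)) (vsval A u) * form (pbase j) w
  + form (vsval B (pdual j)) (vsval A w) * form (pbase j) u
  + form (vsval B (pdual j)) w * form (pbase j) (vsval A u)
  + form (vsval B (pdual j)) u * form (pbase j) (vsval A w)
  - 4%:R / 7%:R * form (vsval A (vsval B (pdual j))) (pbase j) * form u w)).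
  apply: eq_bigr => j _; rewrite big_split -mulr_sumr /= !big_split /= -!mulr_suml -mulr_sumr.
  rewrite big_split /= !form_dual_sum_op (flip A (pbase j)).
  rewrite !(flip A (vsval B _)) !(flip A (pbase j)) !(formC (vsval A _)).
  by field; rewrite k2 k7.
rewrite sumrB !big_split /= -mulr_suml -mulr_sumr !form_dual_sum_op /op_trace.
rewrite (S2_self B (vsval A w)) (S2_self A w) (S2_self B w) -(S2_self A (vsval B u)).
by rewrite !(formC w); ring.
Qed.

Lemma coord_form i (v : W) : coord (vbasis {: W}) i v = form v (pdual i).
Proof.
rewrite {2}(sum_pbase v) linear_sumlz (bigD1 i) //= linearZl_LR /= formC form_pdual //.
rewrite eqxx mulr1 big1 ?addr0 // => j ji.
by rewrite linearZl_LR /= formC form_pdual // eq_sym (negPf ji) mulr0.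
Qed.

(** Passes from dual bases to coordinates, the form of the trace that is available over [R]. *)
Lemma op_traceE (X : W -> W) : linear X ->
  op_trace X = \sum_i coord (vbasis {: W}) i (X (pbase i)).
Proof.
move=> XL; pose h : {linear W -> W} := HB.pack X (GRing.isLinear.Build k _ _ _ X XL).
under [RHS]eq_bigr => i _ do rewrite coord_form.
have hE v : X v = h v by [].
have hs i : form (X (pdual i)) (pbase i) =
    \sum_j form (form (pdual i) (pdual j) *: h (pbase j)) (pbase i).
  rewrite -linear_sumlz; congr form; rewrite hE -{1}(sum_form_pdual k2 (pdual i)) linear_sum.
  by apply: eq_bigr => j _; rewrite linearZ.
rewrite /op_trace (eq_bigr _ (fun i _ => hs i)).
rewrite exchange_big /=; apply: eq_bigr => j _.
rewrite -[in RHS](sum_form_pdual k2 (pdual j)) linear_sumr; apply: eq_bigr => i _.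
by rewrite linearZl_LR linearZr_LR /= (formC (pdual i)).
Qed.

Lemma operator_prod1 (x y : V) u w : form (operator (prod1 x y) u) w =
  - op_trace (fun t => u ## operator x (w ## operator y t))
  - op_trace (fun t => w ## operator x (u ## operator y t))
  + 4%:R / 7%:R * op_trace (fun t => operator x (operator y t)) * form u w.
Proof. by rewrite /operator val_prod1 odot1_op. Qed.

Lemma operator_prod2 (x y : V) u : operator (prod2 x y) u =
  2%:R *: (operator x (operator y u) + operator y (operator x u))
  - (4%:R / 7%:R * op_trace (fun t => operator x (operator y t))) *: u.
Proof. by rewrite /operator val_prod2 odot2_op. Qed.

End TwoProducts.

(** * Equivariance over commutative algebras *)

Section ExtendedForms.

Variables (k : fieldType) (R : comAlgType k).

Definition ext_form (U V : vectType k) (f : U -> V -> k)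
    (u : scalar_ext R U) (v : scalar_ext R V) : R^o :=
  \sum_i \sum_j u 0 i * v 0 j * (f (vbasis {: U})`_i (vbasis {: V})`_j)%:A.

Fact ext_form_linearl (U V : vectType k) (f : U -> V -> k) v :
  linear ((ext_form f)^~ v).
Proof.
move=> a u u'; rewrite /ext_form scaler_sumr -big_split /=.
apply: eq_bigr => i _; rewrite scaler_sumr -big_split /=.
by apply: eq_bigr => j _; rewrite !mxE !mulrDl -!mulrA.
Qed.

Fact ext_form_linearr (U V : vectType k) (f : U -> V -> k) u :
  linear (ext_form f u).
Proof.
move=> a v v'; rewrite /ext_form scaler_sumr -big_split /=.
apply: eq_bigr => i _; rewrite scaler_sumr -big_split /=.
by apply: eq_bigr => j _; rewrite !mxE mulrDr !mulrDl mulrCA -!mulrA.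
Qed.

HB.instance Definition _ (U V : vectType k) (f : U -> V -> k) :=
  bilinear_isBilinear.Build R (scalar_ext R U) (scalar_ext R V) R^o _ _
  (@ext_form U V f) (ext_form_linearl f, ext_form_linearr f).

Lemma ext_form_vec (U V : vectType k) (f : {bilinear U -> V -> k | *%R & *%R}) u v :
  ext_form f (ext_vec R u) (ext_vec R v) = (f u v)%:A.
Proof.
rewrite [in RHS](coord_vbasis (memvf u)) linear_sumlz -/(in_alg R _) rmorph_sum.
apply: eq_bigr => i _; rewrite linearZl_LR [in RHS](coord_vbasis (memvf v)).
rewrite linear_sumr mulr_sumr rmorph_sum; apply: eq_bigr => j _.
by rewrite linearZr_LR !mxE -!/(in_alg R _) !rmorphM mulrA.
Qed.

Definition ext_trace (V : vectType k) (X : scalar_ext R V -> scalar_ext R V) : R^o :=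
  \tr (lin1_mx X).

Lemma ext_traceE (V : vectType k) (X : scalar_ext R V -> scalar_ext R V) :
  ext_trace X = \sum_(i < \dim {: V}) X (ext_vec R (vbasis {: V})`_i) 0 i.
Proof.
apply: eq_bigr => i _; rewrite mxE; congr (X _ 0 i).
apply/rowP => j; rewrite !mxE coord_free ?(basis_free (vbasisP _)) // eqxx /=.
by rewrite eq_sym; case: eqP => _; rewrite ?scale1r ?scale0r.
Qed.

Lemma ext_trace_linear (V : vectType k) (M : lmodType R)
    (X : M -> scalar_ext R V -> scalar_ext R V) :
  (forall t, linear (X^~ t)) -> linear (fun m => ext_trace (X m)).
Proof.
move=> XL a m m'; rewrite !ext_traceE scaler_sumr -big_split /=.
by apply: eq_bigr => i _; rewrite XL !mxE.
Qed.

Lemma ext_trace_conj (V : vectType k) (g g' X X' : scalar_ext R V -> scalar_ext R V) :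
  linear g -> linear X -> linear X' -> cancel g g' -> cancel g' g ->
  (forall t, X' (g t) = g (X t)) -> ext_trace X' = ext_trace X.
Proof.
move=> gL XL X'L gK g'K XX'.
have g'L : linear g' by move=> a u v; apply: (can_inj gK); rewrite gL !g'K.
have row_lin (f : scalar_ext R V -> scalar_ext R V) : linear f ->
    forall u, u *m lin1_mx f = f u.
  move=> fL u; pose h : {linear scalar_ext R V -> scalar_ext R V} :=
    HB.pack f (GRing.isLinear.Build R _ (scalar_ext R V) _ f fL).
  exact: (mul_rV_lin1 h).
have GG' : lin1_mx g *m lin1_mx g' = 1%:M.
  by apply/row_matrixP => i; rewrite row_mul !rowE mulmx1 !row_lin // gK.
have GX : lin1_mx g *m lin1_mx X' = lin1_mx X *m lin1_mx g.
  by apply/row_matrixP => i; rewrite !row_mul !rowE !row_lin // XX'.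
rewrite /ext_trace -[lin1_mx X']mul1mx -(mulmx1C GG') -mulmxA GX.
by rewrite mxtrace_mulC -mulmxA GG' mulmx1.
Qed.

Lemma linear_add (M : lmodType R) (f g : M -> R^o) :
  linear f -> linear g -> linear (fun x => f x + g x).
Proof. by move=> fL gL a x y; rewrite fL gL scalerDr addrACA. Qed.

Lemma linear_opp (M : lmodType R) (f : M -> R^o) :
  linear f -> linear (fun x => - f x).
Proof. by move=> fL a x y; rewrite fL opprD scalerN. Qed.

Lemma linear_mull (M : lmodType R) c (f : M -> R^o) :
  linear f -> linear (fun x => c * f x : R^o).
Proof.
by move=> fL a x y; rewrite fL mulrDr -![a *: _]/(a * _) mulrCA.
Qed.

Lemma linear_mul (M : lmodType R) c d (f : M -> R^o) :
  linear f -> linear (fun x => c * f x * d : R^o).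
Proof.
move=> fL a x y; rewrite fL mulrDr mulrDl; congr (_ + _).
by rewrite -![a *: _]/(a * _) !mulrA (mulrC a).
Qed.

End ExtendedForms.

Section ExtendedProducts.

Variables (k : fieldType) (O : octonion_algebra k) (R : comAlgType k).
Hypotheses (k2 : 2%:R != 0 :> k) (k7 : 7%:R != 0 :> k).
Local Notation W := (pure O).
Local Notation V := (V27T O).
Local Notation OR := (scalar_ext R O).
Local Notation WR := (scalar_ext R W).
Local Notation VR := (scalar_ext R V).
Local Notation "a ## b" := (malcev a b) (at level 40, left associativity).
Local Notation mul := (ext_bil (omul O) : OR -> OR -> OR).
Local Notation mal := (ext_bil (@malcev k O) : WR -> WR -> WR).
Local Notation op := (ext_bil (@operator k O) : VR -> WR -> WR).
Local Notation frm := (ext_form (@form k O) : WR -> WR -> R^o).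
Local Notation pr := (ext_form (@pairing k O) : OR -> OR -> R^o).
Local Notation tr := (@ext_trace k R W).
Local Notation one := (ext_vec R (oone O) : OR).

Lemma ext_trace_op (X : W -> W) (XR : WR -> WR) : linear X ->
  (forall v, XR (ext_vec R v) = ext_vec R (X v)) -> tr XR = (op_trace X)%:A.
Proof.
move=> XL XX; rewrite ext_traceE op_traceE // -/(in_alg R _) rmorph_sum.
by apply: eq_bigr => i _; rewrite XX mxE.
Qed.

Lemma form_ext_vec (u w : W) : frm (ext_vec R u) (ext_vec R w) = (form u w)%:A.
Proof. exact: (ext_form_vec R (@form k O)). Qed.

Lemma pairing_ext_vec (x y : O) : pr (ext_vec R x) (ext_vec R y) = (pairing x y)%:A.
Proof. exact: (ext_form_vec R (@pairing k O)). Qed.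

Lemma ext_form_inj (u u' : WR) : (forall w, frm u w = frm u' w) -> u = u'.
Proof.
have coordE (v : WR) i : frm v (ext_vec R (pdual i)) = v 0 i.
  move: v; apply: (ext_vec_ind (M := R^o)) => [a v v'|a v v'|v].
  - exact: linearPl.
  - by rewrite !mxE.
  by rewrite form_ext_vec mxE coord_form.
by move=> uu'; apply/rowP => i; rewrite -!coordE uu'.
Qed.

Let c47 : R := (4%:R / 7%:R : k)%:A.

(** Both sides are linear in each of [x], [y], [u], [w], so the formula descends to
    [operator_prod1]. Its right side involves only operations whose compatibility with automorphisms
    can be checked one by one. *)
Lemma ext_prod1 (x y : VR) (u w : WR) : frm (op (ext_bil (@prod1 k O) x y) u) w =
  - tr (fun t => mal u (op x (mal w (op y t))))
  - tr (fun t => mal w (op x (mal u (op y t))))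
  + c47 * tr (fun t => op x (op y t)) * frm u w.
Proof.
move: x; apply: (ext_vec_ind (M := R^o)) => [a x x'||x]; first by rewrite !linearPl.
  apply: linear_add; first (apply: linear_add; apply: linear_opp).
  - by apply: ext_trace_linear => t a x x'; rewrite !(linearPl, linearPr).
  - by apply: ext_trace_linear => t a x x'; rewrite !(linearPl, linearPr).
  apply: linear_mul; apply: ext_trace_linear => t a x x'; exact: linearPl.
move: y; apply: (ext_vec_ind (M := R^o)) => [a y y'||y]; first by rewrite linearPr !linearPl.
  apply: linear_add; first (apply: linear_add; apply: linear_opp).
  - by apply: ext_trace_linear => t a y y'; rewrite !(linearPl, linearPr).
  - by apply: ext_trace_linear => t a y y'; rewrite !(linearPl, linearPr).
  by apply: linear_mul; apply: ext_trace_linear => t a y y'; rewrite !(linearPl, linearPr).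
move: u; apply: (ext_vec_ind (M := R^o)) => [a u u'||u]; first by rewrite linearPr linearPl.
  apply: linear_add; first (apply: linear_add; apply: linear_opp).
  - by apply: ext_trace_linear => t a u u'; rewrite !(linearPl, linearPr).
  - by apply: ext_trace_linear => t a u u'; rewrite !(linearPl, linearPr).
  by apply: linear_mull => a u u'; exact: linearPl.
move: w; apply: (ext_vec_ind (M := R^o)) => [a w w'||w]; first by rewrite linearPr.
  apply: linear_add; first (apply: linear_add; apply: linear_opp).
  - by apply: ext_trace_linear => t a w w'; rewrite !(linearPl, linearPr).
  - by apply: ext_trace_linear => t a w w'; rewrite !(linearPl, linearPr).
  by apply: linear_mull => a w w'; exact: linearPr.
have L3 (v1 v2 : W) : linear (fun t => v1 ## operator x (v2 ## operator y t)).
  by move=> a t t'; rewrite !linearPr.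
have L2 : linear (fun t => operator x (operator y t)) by move=> a t t'; rewrite !linearPr.
rewrite !ext_bil_vec form_ext_vec /=.
rewrite (ext_trace_op (L3 u w)) => [|v]; last by rewrite !ext_bil_vec.
rewrite (ext_trace_op (L3 w u)) => [|v]; last by rewrite !ext_bil_vec.
rewrite (ext_trace_op L2) => [|v]; last by rewrite !ext_bil_vec.
rewrite form_ext_vec operator_prod1 // /c47 -!/(in_alg R _).
by rewrite rmorphD rmorphB rmorphN !rmorphM.
Qed.

Lemma ext_prod2 (x y : VR) (u : WR) : op (ext_bil (@prod2 k O) x y) u =
  (2%:R : k)%:A *: (op x (op y u) + op y (op x u))
  - (c47 * tr (fun t => op x (op y t))) *: u.
Proof.
have T_x : linear (fun x => (c47 * tr (fun t => op x (op y t))) *: u).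
  move=> a z z'; rewrite (ext_trace_linear (X := fun x t => op x (op y t))) => [|t b v v'].
    rewrite mulrDr scalerDl scalerA; congr (_ *: _ + _); exact: mulrCA.
  exact: linearPl.
have T_y x' : linear (fun y => (c47 * tr (fun t => op x' (op y t))) *: u).
  move=> a z z'; rewrite (ext_trace_linear (X := fun y t => op x' (op y t))) => [|t b v v'].
    rewrite mulrDr scalerDl scalerA; congr (_ *: _ + _); exact: mulrCA.
  by rewrite linearPl linearPr.
have comb (c a : R) (A A' B B' T T' : WR) :
    c *: ((a *: A + A') + (a *: B + B')) - (a *: T + T')
    = a *: (c *: (A + B) - T) + (c *: (A' + B') - T').
  by rewrite addrACA -scalerDr [LHS]addrC (scalerDr c) (scale_swap c) addrC opprD addrACA -scalerBr.
move: x T_x T_y => x T_x T_y; move: x; apply: ext_vec_ind => [a x x'|a x x'|x].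
- by rewrite !linearPl.
- by rewrite T_x !linearPl linearPr comb.
have {T_x}T_y := T_y (ext_vec R x).
move: y T_y => y T_y; move: y; apply: ext_vec_ind => [a y y'|a y y'|y].
- by rewrite linearPr linearPl.
- by rewrite T_y !(linearPl, linearPr) comb.
move=> {T_y}; move: u; apply: ext_vec_ind => [a u u'|a u u'|u].
- exact: linearPr.
- by rewrite !linearPr (scalerDr (c47 * _)) (scale_swap (c47 * _)) comb.
have L2 : linear (fun t => operator x (operator y t)) by move=> b t t'; rewrite !linearPr.
rewrite (ext_trace_op L2) => [|v]; last by rewrite !ext_bil_vec.
rewrite !ext_bil_vec /= operator_prod2 // ext_vecB !ext_vecZ ext_vecD.
by rewrite /c47 -!/(in_alg R _) rmorphM.
Qed.

(** * Invariance of the pairing, of the Malcev product and of traces *)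

Section Automorphism.

Variable g : {linear OR -> OR}.
Hypothesis g_aut : is_aut g.

Let gM x y : g (mul x y) = mul (g x) (g y).
Proof. by have [_ ->] := g_aut. Qed.

Let g_inj : injective g.
Proof. by have [/bij_inj] := g_aut. Qed.

Lemma ext_mul1l x : mul one x = x.
Proof.
move: x; apply: ext_vec_ind => [a x y|//|x]; first exact: linearPr.
by rewrite ext_bil_vec omul1l.
Qed.

Lemma ext_mul1r x : mul x one = x.
Proof.
move: x; apply: ext_vec_ind => [a x y|//|x]; first exact: linearPl.
by rewrite ext_bil_vec omul1r.
Qed.

Lemma aut_one : g one = one.
Proof.
have [g' _ gK] := g_aut.1.
have g1 z : mul (g one) z = z by rewrite -(gK z) -gM ext_mul1l.
by have := g1 one; rewrite ext_mul1r.
Qed.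

Lemma ext_anticomm x y : mul x y + mul y x =
  pr x one *: y + pr y one *: x - pr x y *: one.
Proof.
have lin (a s : R) (t t' p p' : R^o) (z z' v : OR) : (a *: t + t') *: v + s *: (a *: z + z')
    - (a *: p + p') *: one = a *: (t *: v + s *: z - p *: one) + (t' *: v + s *: z' - p' *: one).
  by apply/rowP => i; rewrite !mxE -![a *: _]/(a * _); ring.
move: x; apply: ext_vec_ind => [a x x'|a x x'|x].
- by rewrite linearPl linearPr scalerDr addrACA.
- by rewrite !linearPl lin.
move: y; apply: ext_vec_ind => [a y y'|a y y'|y].
- by rewrite linearPl linearPr scalerDr addrACA.
- by rewrite linearPl linearPr [_ *: (a *: y + y') + _]addrC lin ![_ *: ext_vec R x + _]addrC.
rewrite !ext_bil_vec !pairing_ext_vec -ext_vecD omul_anticomm.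
by rewrite ext_vecB ext_vecD !ext_vecZ.
Qed.

Lemma ext_pairing_one1 : pr one one = (2%:R : k)%:A.
Proof. by rewrite pairing_ext_vec pairing11. Qed.

(** The defects [l] and [q] measure the failure of invariance. Applying [g] to the anticommutator
    formula yields [lq]. Since [R] may have zero divisors, [l] is killed by testing on vectors
    defined over [k], whose nonzero norms are invertible; then [q] vanishes as well. *)
Lemma aut_pairing x y : pr (g x) one = pr x one /\ pr (g x) (g y) = pr x y.
Proof.
pose l x : R^o := pr (g x) one - pr x one.
pose q x y : R^o := pr (g x) (g y) - pr x y.
have lq u v : l u *: v + l v *: u = q u v *: one.
  apply: g_inj; rewrite linearD !linearZ /= aut_one /l /q.
  have := ext_anticomm (g u) (g v); rewrite -!gM -linearD ext_anticomm => E.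
  move: E; rewrite linearB linearD !linearZ /= aut_one => E.
  apply: (eq_of_subr (esym E)); apply/rowP => i; rewrite !mxE; ring.
have l_linear : linear l.
  by move=> a u v; rewrite /l linearP !linearPl scalerBr opprD addrACA.
have l_one : l one = 0 by rewrite /l aut_one subrr.
(* In [lq v v], pairing with the pure vector [v] removes the identity and leaves 2 l(v) times the
   norm of [w]. *)
have l_aniso (w : W) : form w w != 0 -> l (ext_vec R (vsval w)) = 0.
  move=> ww; set v := ext_vec R (vsval w).
  have := congr1 (pr v) (lq v v).
  have -> : pr v (q v v *: one) = 0.
    by rewrite linearZr_LR /= pairing_ext_vec pure_pairing1 scale0r scaler0.
  rewrite linearDr linearZr_LR /= pairing_ext_vec -/(form w w) -mulr2n -scaler_nat.
  rewrite -![_ *: _]/(_ * _) mulr_algr mulr_natl -scaler_nat scalerA => /eqP.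
  by rewrite scaler_eq0 mulf_eq0 (negPf k2) (negPf ww) => /eqP.
pose h : {linear OR -> R^o} := HB.pack l (GRing.isLinear.Build R OR R^o _ l l_linear).
have [e fe] := exists_frame O k2.
have l_pure (w : W) : l (ext_vec R (vsval w)) = 0.
  rewrite (orth_expansion k2 (frame_norm fe) (frame_orth fe) erefl w) linear_sum.
  rewrite (eq_bigr (fun i => form (e i) w / form (e i) (e i) *: vsval (e i))) => [|i _];
    last exact: linearZ.
  rewrite ext_vec_comb -[l _]/(h _) linear_sum big1 // => i _.
  by rewrite linearZ /= l_aniso ?scaler0 //; apply: frame_norm fe _.
have l0 u : l u = 0.
  move: u; apply: (ext_vec_ind (psi := fun=> 0)) => [|a u v|u]; first exact: l_linear.
    by rewrite scaler0 addr0.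
  rewrite (octonion_decomposition k2 u) ext_vec_linear -[l _]/(h _) linearD linearZ /=.
  by rewrite l_one l_pure scaler0 addr0.
have q0 : q x y = 0.
  have := lq x y; rewrite !l0 !scale0r addr0 => /esym/(congr1 (pr one)).
  rewrite linearZr_LR /= ext_pairing_one1 linear0r -[_ *: _]/(_ * _) mulr_algr => /eqP.
  by rewrite scaler_eq0 (negPf k2) => /eqP.
by split; apply/eqP; rewrite -subr_eq0; apply/eqP; [exact: l0 | exact: q0].
Qed.

Local Notation incl := (ext_lin (@vsval _ _ (pureV O)) : WR -> OR).
Local Notation proj := (ext_lin (vsproj (pureV O)) : OR -> WR).

Lemma incl_vec (w : W) : incl (ext_vec R w) = ext_vec R (vsval w).
Proof. exact: ext_lin_vec. Qed.

Lemma proj_incl w : proj (incl w) = w.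
Proof.
move: w; apply: ext_vec_ind => [a u v|//|w]; first by rewrite !linearP.
by rewrite incl_vec ext_lin_vec /= vsvalK.
Qed.

Lemma incl_inj : injective incl.
Proof. exact: can_inj proj_incl. Qed.

Lemma incl_pure w : pr (incl w) one = 0.
Proof.
move: w; apply: (ext_vec_ind (M := R^o) (psi := fun=> 0)) => [a u v|a u v|w].
- by rewrite linearP linearPl.
- by rewrite scaler0 addr0.
by rewrite incl_vec pairing_ext_vec pure_pairing1 scale0r.
Qed.

Lemma incl_proj y : pr y one = 0 -> incl (proj y) = y.
Proof.
(* The values of [vsproj] outside the pure octonions are not controlled, so the component along the
   identity is removed before projecting. *)
have E z : incl (proj (z - (2%:R^-1 : k)%:A * pr z one *: one))
    = z - (2%:R^-1 : k)%:A * pr z one *: one.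
  have lin : linear (fun z : OR => z - (2%:R^-1 : k)%:A * pr z one *: one).
    move=> a u v; rewrite linearPl; apply/rowP => i; rewrite !mxE /= -![a *: _]/(a * _).
    by ring.
  move: z; apply: ext_vec_ind => [a u v|//|z]; first by rewrite lin !linearP.
  rewrite pairing_ext_vec -/(in_alg R _) -!rmorphM -[_ *: one]ext_vecZ -ext_vecB.
  rewrite ext_lin_vec ext_lin_vec /= vsprojK // mem_pureV !pairing_expand pairing11.
  by rewrite mulrAC mulVf // mul1r subrr.
by move=> y0; have := E y; rewrite y0 mulr0 scale0r subr0.
Qed.

Lemma incl_malcev u w : incl (mal u w) = mul (incl u) (incl w) - mul (incl w) (incl u).
Proof.
move: u; apply: ext_vec_ind => [a u u'|a u u'|u].
- by rewrite linearPl linearP.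
- by rewrite !linearP !(linearPl, linearPr) /= scalerBr opprD addrACA.
move: w; apply: ext_vec_ind => [a w w'|a w w'|w].
- by rewrite linearPr linearP.
- by rewrite !linearP !(linearPl, linearPr) /= scalerBr opprD addrACA.
by rewrite !ext_bil_vec !incl_vec !ext_bil_vec /= val_malcev ext_vecB.
Qed.

Lemma form_incl u w : frm u w = pr (incl u) (incl w).
Proof.
move: u; apply: (ext_vec_ind (M := R^o)) => [a u u'|a u u'|u].
- exact: linearPl.
- by rewrite linearP linearPl.
move: w; apply: (ext_vec_ind (M := R^o)) => [a w w'|a w w'|w].
- exact: linearPr.
- by rewrite linearP linearPr.
by rewrite !incl_vec form_ext_vec pairing_ext_vec.
Qed.

(** As [g] preserves the pairing with the identity, the projection in [aut_pure] loses nothing, and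
    properties of [g] pass to W. *)
Lemma incl_aut_pure w : incl (aut_pure g w) = g (incl w).
Proof. by rewrite incl_proj // (aut_pairing _ 0).1 incl_pure. Qed.

Lemma aut_pure_malcev u w : aut_pure g (mal u w) = mal (aut_pure g u) (aut_pure g w).
Proof.
by apply: incl_inj; rewrite incl_malcev !incl_aut_pure incl_malcev linearB /= !gM.
Qed.

Lemma aut_pure_form u w : frm (aut_pure g u) (aut_pure g w) = frm u w.
Proof. by rewrite !form_incl !incl_aut_pure (aut_pairing _ _).2. Qed.

Lemma aut_pure_bij : exists h : WR -> WR, cancel (aut_pure g) h /\ cancel h (aut_pure g).
Proof.
have [g' gK g'K] := g_aut.1; exists (fun w => proj (g' (incl w))); split=> w.
  by rewrite incl_aut_pure gK proj_incl.
apply: incl_inj; rewrite incl_aut_pure incl_proj ?g'K //.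
by rewrite -(aut_pairing _ 0).1 g'K incl_pure.
Qed.

Section Images.

Variables x x' y y' : VR.
Hypotheses (xx' : aut_image g x x') (yy' : aut_image g y y').

(** The operators [x'] and [y'] are the conjugates of [x] and [y] by [aut_pure g], and a trace is
    invariant under conjugation. *)
Lemma ext_trace_image2 :
  tr (fun t => op x' (op y' t)) = tr (fun t => op x (op y t)).
Proof.
have [h [gK hK]] := aut_pure_bij.
have L z z' : linear (fun t => op z (op z' t)) by move=> a u v; rewrite !linearPr.
apply: (ext_trace_conj (aut_pure_linear g) (L _ _) (L _ _) gK hK) => t.
by rewrite yy' xx'.
Qed.

Lemma ext_trace_image4 u w :
  tr (fun t => mal (aut_pure g u) (op x' (mal (aut_pure g w) (op y' t)))) =
  tr (fun t => mal u (op x (mal w (op y t)))).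
Proof.
have [h [gK hK]] := aut_pure_bij.
have L z z' u' w' : linear (fun t => mal u' (op z (mal w' (op z' t)))).
  by move=> a v v'; rewrite !linearPr.
apply: (ext_trace_conj (aut_pure_linear g) (L _ _ _ _) (L _ _ _ _) gK hK) => t.
by rewrite yy' -aut_pure_malcev xx' -aut_pure_malcev.
Qed.

Lemma prod1_image : aut_image g (ext_bil (@prod1 k O) x y) (ext_bil (@prod1 k O) x' y').
Proof.
have [h [_ hK]] := aut_pure_bij.
move=> u; apply: ext_form_inj => w; rewrite -(hK w) aut_pure_form !ext_prod1.
by rewrite !ext_trace_image4 ext_trace_image2 aut_pure_form.
Qed.

Lemma prod2_image : aut_image g (ext_bil (@prod2 k O) x y) (ext_bil (@prod2 k O) x' y').
Proof.
pose G : {linear WR -> WR} := HB.pack (aut_pure g)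
  (GRing.isLinear.Build R WR WR _ (aut_pure g) (aut_pure_linear g)).
move=> u; rewrite !ext_prod2 ext_trace_image2 yy' !xx' yy'.
have GB a b c v w : G (a *: (v + w) - b *: c) = a *: (G v + G w) - b *: G c.
  by rewrite linearB linearZ linearD; congr (_ - _); exact: linearZ.
by rewrite -![aut_pure g _]/(G _) GB.
Qed.

End Images.

End Automorphism.

End ExtendedProducts.

(** * Classification *)

Section EquivariantProducts.

Variables (k : fieldType) (O : octonion_algebra k).
Hypotheses (k2 : 2%:R != 0 :> k) (k7 : 7%:R != 0 :> k).
Local Notation W := (pure O).
Local Notation V := (V27T O).
Local Notation "a ## b" := (malcev a b) (at level 40, left associativity).

Lemma prod1_equivariant : equivariant (@prod1 k O).
Proof. by move=> R g g_aut x y x' y'; apply: prod1_image. Qed.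

Lemma prod2_equivariant : equivariant (@prod2 k O).
Proof. by move=> R g g_aut x y x' y'; apply: prod2_image. Qed.

Definition product_comb (a b : k) (f f' : V -> V -> V) (x y : V) : V :=
  a *: f x y + b *: f' x y.

Section Combination.

Variables (a b : k) (f f' : {bilinear V -> V -> V}).

Fact product_comb_linearl y : linear ((product_comb a b f f')^~ y).
Proof.
move=> t u v; rewrite /product_comb !linearPl !scalerDr addrACA.
by rewrite !(scale_swap _ t).
Qed.

Fact product_comb_linearr x : linear (product_comb a b f f' x).
Proof.
move=> t u v; rewrite /product_comb !linearPr !scalerDr addrACA.
by rewrite !(scale_swap _ t).
Qed.

HB.instance Definition _ := bilinear_isBilinear.Build k V V V _ _
  (product_comb a b f f') (product_comb_linearl, product_comb_linearr).

End Combination.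

Lemma ext_bil_comb (R : comAlgType k) a b (f f' : V -> V -> V)
    (x y : scalar_ext R V) : ext_bil (product_comb a b f f') x y =
  a%:A *: ext_bil f x y + b%:A *: ext_bil f' x y.
Proof.
rewrite /ext_bil !scaler_sumr -big_split; apply: eq_bigr => i _.
rewrite !scaler_sumr -big_split; apply: eq_bigr => j _.
by rewrite /product_comb ext_vecD !ext_vecZ scalerDr !(scale_swap (_ * _)).
Qed.

Lemma equivariant_comb a b (f f' : V -> V -> V) :
  equivariant f -> equivariant f' -> equivariant (product_comb a b f f').
Proof.
move=> fG f'G R g g_aut x y x' y' xx' yy' w.
have gL := aut_pure_linear g.
rewrite !ext_bil_comb !linearDl !linearZl_LR /=.
rewrite (fG R g g_aut _ _ _ _ xx' yy') (f'G R g g_aut _ _ _ _ xx' yy').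
pose G : {linear scalar_ext R W -> scalar_ext R W} := HB.pack (aut_pure g)
  (GRing.isLinear.Build R (scalar_ext R W) (scalar_ext R W) _ (aut_pure g) gL).
rewrite -![aut_pure g _]/(G _) linearD.
by congr (_ + _); apply: esym; exact: linearZ.
Qed.

Lemma equivariant_inf (f : {bilinear V -> V -> V}) : equivariant f -> inf_equivariant f.
Proof.
have [R [eps [eps0 eps2]]] := exists_dual_number k.
move=> fG D Dd x x' y y' xx' yy'.
exact: (equivariant_der_image k2 Dd eps0 eps2 fG xx' yy').
Qed.

Section OperatorTrace.

Lemma op_trace_eq (X Y : W -> W) : X =1 Y -> op_trace X = op_trace Y.
Proof. by move=> XY; apply: eq_bigr => i _; rewrite XY. Qed.

Lemma op_traceD (X Y : W -> W) :
  op_trace (fun t => X t + Y t) = op_trace X + op_trace Y.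
Proof. by rewrite -big_split; apply: eq_bigr => i _; rewrite form_expand. Qed.

Lemma op_traceZ c (X : W -> W) : op_trace (fun t => c *: X t) = c * op_trace X.
Proof. by rewrite mulr_sumr; apply: eq_bigr => i _; rewrite form_expand. Qed.

Lemma op_trace_rank1 (p q : W) : op_trace (fun t => form p t *: q) = form p q.
Proof.
rewrite -form_dual_sum //; apply: eq_bigr => i _.
by rewrite form_expand (formC p) (formC q).
Qed.

Lemma op_trace_id : op_trace (fun t : W => t) = 7%:R.
Proof.
rewrite /op_trace (eq_bigr (fun=> 1)) => [|i _]; last by rewrite form_pdual // eqxx.
by rewrite sumr_const card_ord dim_pure.
Qed.

End OperatorTrace.

(** * Diagonal coefficients of the two products on squares of orthogonal vectors *)

Section FrameValues.

Variables a b u : W.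
Hypothesis ab : form a b = 0.

Let k49 : 49%:R != 0 :> k. Proof. by rewrite (natrM _ 7 7) mulf_neq0. Qed.

Lemma operator_square (c t : W) : operator (traceless c c) t = form c t *: c - (form c c / 7%:R) *: t.
Proof.
rewrite operator_traceless // symopE; congr (_ - _).
by apply: (form_inj k2) => v; rewrite !form_expand; field.
Qed.

Lemma trace_square_square :
  op_trace (fun t => operator (traceless a a) (operator (traceless b b) t)) =
  - (form a a * form b b / 7%:R).
Proof.
rewrite (op_trace_eq (Y := fun t => (- (form a a / 7%:R)) *: (form b t *: b)
   + ((- (form b b / 7%:R)) *: (form a t *: a) + (form a a * form b b / 49%:R) *: t))).
  by rewrite !op_traceD !op_traceZ !op_trace_rank1 op_trace_id; field; rewrite k7 k49.
move=> t; rewrite !operator_square; apply: (form_inj k2) => v.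
by rewrite !form_expand ab; field; rewrite k7 k49.
Qed.

Lemma coef_prod1 : matrix_coef (prod1 (traceless a a) (traceless b b)) u u =
  2%:R * form u (a ## b) ^+ 2
  + 4%:R / 7%:R * (form a a * form b u ^+ 2 + form b b * form a u ^+ 2)
  - 36%:R / 49%:R * form a a * form b b * form u u.
Proof.
rewrite /matrix_coef operator_prod1 // trace_square_square.
(* The double product identity for [u] writes the operator under the trace as three operators of
   rank one plus a scalar, whose traces are immediate. *)
pose v := form a (u ## b) *: (u ## a) - (form a a / 7%:R) *: (u ## (u ## b)).
pose r := form a a * form b b / 49%:R.
rewrite (op_trace_eq (Y := fun t => form b t *: v
  + ((form b b / 7%:R) *: (form (u ## a) t *: (u ## a))
  + ((2%:R * r) *: (form u t *: u) + (- (2%:R * r * form u u)) *: t)))).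
  rewrite !op_traceD !op_traceZ !op_trace_rank1 op_trace_id /v /r !form_expand.
  have -> : form b (u ## a) = form u (a ## b).
    by rewrite formC form_malcev.
  have -> : form a (u ## b) = - form u (a ## b).
    by rewrite formC form_malcev (malcevC b) form_expand.
  have -> : form b (u ## (u ## b)) = - form (u ## b) (u ## b).
    by rewrite -form_malcev (malcevC b) form_expand.
  rewrite !form_malcev_malcev // !(formC u a) !(formC u b).
  by field; rewrite k7 k49.
move=> t; rewrite !operator_square !malcev_expand; apply: (form_inj k2) => z.
rewrite /v /r (malcev_malcev k2 u t) !form_expand.
have -> : form a (u ## t) = - form (u ## a) t.
  by rewrite -form_malcev (malcevC a) form_expand.
by field; rewrite k7 k49.
Qed.

Lemma coef_prod2 : matrix_coef (prod2 (traceless a a) (traceless b b)) u u =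
  8%:R / 49%:R * form a a * form b b * form u u
  - 4%:R / 7%:R * (form b b * form a u ^+ 2 + form a a * form b u ^+ 2).
Proof.
rewrite /matrix_coef operator_prod2 // trace_square_square !operator_square.
rewrite !form_expand (formC b a) ab.
by field; rewrite k7 k49.
Qed.

End FrameValues.

Theorem equivariant_product_classification (k3 : 3%:R != 0 :> k) (k5 : 5%:R != 0 :> k)
    (f : {bilinear V -> V -> V}) : commutative f -> equivariant f ->
  exists c1 c2, forall x y, f x y = c1 *: prod1 x y + c2 *: prod2 x y.
Proof.
move=> fC fG; have [e fe] := exists_frame O k2.
set i0 : 'I_7 := inord 0; set i1 : 'I_7 := inord 1.
set i2 : 'I_7 := inord 2; set i3 : 'I_7 := inord 3.
have en := frame_norm fe; have eo := frame_orth fe.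
have ord_neq (i j : nat) : (i < 7)%N -> (j < 7)%N -> i != j -> inord i != inord j :> 'I_7.
  by move=> i7 j7 ij; rewrite -(inj_eq val_inj) /= !inordK.
have o (i j : nat) : (i < 7)%N -> (j < 7)%N -> i != j -> form (e (inord i)) (e (inord j)) = 0.
  by move=> i7 j7 ij; rewrite eo // ord_neq.
set n0 := form (e i0) (e i0); set n1 := form (e i1) (e i1).
set n2 := form (e i2) (e i2); set n3 := form (e i3) (e i3).
have [z0 z1 z2 z3] : [/\ n0 != 0, n1 != 0, n2 != 0 & n3 != 0] by split; apply: en.
have o01 : form (e i0) (e i1) = 0 by apply: o.
have n2E : n2 = 2%:R * n0 * n1.
  by rewrite /n2 -(frame_line fe) form_malcev_malcev // o01; rewrite /n0 /n1; ring.
pose ev h i : k := matrix_coef (h (traceless (e i0) (e i0)) (traceless (e i1) (e i1))) (e i) (e i).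
have line : e i0 ## e i1 = e i2 := frame_line fe.
have o02 : form (e i0) (e i2) = 0 by apply: o.
have o12 : form (e i1) (e i2) = 0 by apply: o.
have o03 : form (e i0) (e i3) = 0 by apply: o.
have o13 : form (e i1) (e i3) = 0 by apply: o.
have o32 : form (e i3) (e i2) = 0 by apply: o.
have k49 : 49%:R != 0 :> k by rewrite (natrM _ 7 7) mulf_neq0.
have E1 : (ev (@prod1 k O) i0 = - (8%:R / 49%:R) * n0 ^+ 2 * n1)
  * (ev (@prod1 k O) i2 = 2%:R * n2 ^+ 2 - 36%:R / 49%:R * n0 * n1 * n2)
  * (ev (@prod1 k O) i3 = - (36%:R / 49%:R) * n0 * n1 * n3).
  rewrite /ev !coef_prod1 // line (formC (e i1) (e i0)) o01 o02 o12 o03 o13 o32.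
  by split; first split; rewrite -/n0 -/n1 -/n2 -/n3; field; rewrite k49 k7.
have E2 : (ev (@prod2 k O) i0 = - (20%:R / 49%:R) * n0 ^+ 2 * n1)
  * (ev (@prod2 k O) i2 = 8%:R / 49%:R * n0 * n1 * n2)
  * (ev (@prod2 k O) i3 = 8%:R / 49%:R * n0 * n1 * n3).
  rewrite /ev !coef_prod2 // (formC (e i1) (e i0)) o01 o02 o12 o03 o13.
  by split; first split; rewrite -/n0 -/n1 -/n2 -/n3; field; rewrite k49 k7.
(* The numbers [a2] and [a3] are the normalized defects of [f] in the two equations of
   [vanishing_criterion]. By [n2E], the same defects are -24/7 and 4/7 for [prod1], and both -4/7
   for [prod2]; [c1] and [c2] solve the resulting linear system, so that the difference [h] has no
   defect. *)
pose a2 : k := (ev f i0 * n2 - ev f i2 * n0) / (n0 ^+ 2 * n1 * n2).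
pose a3 : k := (ev f i0 * n3 - ev f i3 * n0) / (n0 ^+ 2 * n1 * n3).
pose c1 : k := - (a2 - a3) / 4%:R; pose c2 : k := c1 - 7%:R / 4%:R * a3.
have k4 : 4%:R != 0 :> k by rewrite (natrM _ 2 2) mulf_neq0.
exists c1, c2 => x y.
pose p12 : {bilinear V -> V -> V} := product_comb c1 c2 (@prod1 k O) (@prod2 k O).
pose h : {bilinear V -> V -> V} := product_comb 1 (-1) f p12.
have hE z t : h z t = f z t - (c1 *: prod1 z t + c2 *: prod2 z t).
  by rewrite /h /= /product_comb scale1r scaleN1r.
have hC : commutative h by move=> z t; rewrite !hE fC prod1C prod2C.
have hG : equivariant h.
  apply: equivariant_comb fG _; apply: equivariant_comb.
    exact: prod1_equivariant.
  exact: prod2_equivariant.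
have ev_h i : ev h i = ev f i - (c1 * ev (@prod1 k O) i + c2 * ev (@prod2 k O) i).
  by rewrite /ev hE -scaleN1r !matrix_coef_expand mulN1r.
apply/eqP; rewrite -subr_eq0 -hE; apply/eqP.
apply: (vanishing_criterion k2 k7 hC (equivariant_inf hG) fe k3 k5).
  rewrite -/i0 -/i1 -/i2 -/(ev h i0) -/(ev h i2) !ev_h !E1 !E2 /c2 /c1 /a2 /a3.
  by rewrite -/n0 -/n2 n2E; field; rewrite ?k2 ?k7 ?k49 ?k4 ?z0 ?z1 ?z3.
rewrite -/i0 -/i1 -/i3 -/(ev h i0) -/(ev h i3) !ev_h !E1 !E2 /c2 /c1 /a2 /a3.
by rewrite -/n0 -/n3 n2E; field; rewrite ?k2 ?k7 ?k49 ?k4 ?z0 ?z1 ?z3.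
Qed.

End EquivariantProducts.

Theorem proposition3p8 (k : fieldType) (O : octonion_algebra k)
    (char_k : [pchar k] =i pred0 \/ exists2 p : nat, p \in [pchar k] & (7 < p)%N) :
  [/\ forall x y : S2 O,
        x \in V27 O -> y \in V27 O -> odot1 x y \in V27 O,
      forall x y : S2 O,
        x \in V27 O -> y \in V27 O -> odot2 x y \in V27 O
    & forall f : {bilinear V27T O -> V27T O -> V27T O},
        (commutative f /\ equivariant f) <->
        exists c1 c2 : k, forall x y : V27T O,
          vsval (f x y) = c1 *: odot1 (vsval x) (vsval y)
                          + c2 *: odot2 (vsval x) (vsval y)].
Proof.
have small q : prime q -> (q <= 7)%N -> q%:R != 0 :> k.
  move=> q_prime q7; apply/negP => q0.
  have qk : q \in [pchar k] by rewrite inE q_prime.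
  case: char_k => [/(_ q)|[p pk p7]]; first by rewrite qk.
  move: pk; rewrite (pcharf_eq qk) => /eqP pq.
  by move: p7; rewrite pq ltnNge q7.
have k2 := small 2 isT isT; have k3 := small 3 isT isT.
have k5 := small 5 isT isT; have k7 := small 7 isT isT.
split=> [x y|x y|f]; [exact: odot1_V27 | exact: odot2_V27 | split].
  case=> fC fG; have [c1 [c2 fE]] := equivariant_product_classification k2 k7 k3 k5 fC fG.
  by exists c1, c2 => x y; rewrite fE linearD !linearZ /= val_prod1 // val_prod2.
move=> [c1 [c2 fE]].
have {}fE x y : f x y = product_comb c1 c2 (@prod1 k O) (@prod2 k O) x y.
  apply: val_inj; apply: etrans (fE x y) _.
  rewrite -[RHS]/(vsval (c1 *: prod1 x y + c2 *: prod2 x y)) linearD !linearZ /=.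
  by rewrite val_prod1 // val_prod2.
split=> [x y|]; first by rewrite !fE /product_comb prod1C prod2C.
move=> R g g_aut x y x' y' xx' yy'.
have E z t : ext_bil f z t =
    ext_bil (product_comb c1 c2 (@prod1 k O) (@prod2 k O)) z t :> scalar_ext R (V27T O).
  by apply: eq_bigr => i _; apply: eq_bigr => j _; rewrite fE.
rewrite !E; apply: equivariant_comb g_aut _ _ _ _ xx' yy'.
- exact: prod1_equivariant.
- exact: prod2_equivariant.
Qed.
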